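(* Let $d\geq 1$ and let $\mathcal{C}$ be a $d$-arrangement of $k\geq 3$ curves in $\mathbb{P}^2_{\mathbb{C}}$ with $s$ intersection points, such that $k\leq s$. Let $\Bbbk$ be a field and let $I(G)\subset \Bbbk[x_1,\dots,x_s,y_1,\dots,y_k]$ be the edge ideal of the Levi graph $G$ of $\mathcal{C}$. Then for every integer $q\geq 1$ $$\mathrm{reg}(I(G)^q)\leq 2q+k-1,$$ where $\mathrm{reg}$ denotes the Castelnuovo-Mumford regularity.
   Context: An arrangement $\mathcal{C}=\{C_1,\dots,C_k\}$ of $k\geq 3$ (distinct) curves in $\mathbb{P}^2_{\mathbb{C}}$ is a $d$-arrangement if all $C_i$ are smooth of the same degree $d\geq 1$ and all points of $\mathrm{Sing}(\mathcal{C})$ are ordinary intersection points, i.e. they look locally like intersections of lines (the curves through the point have pairwise distinct tangents there). Here $\mathrm{Sing}(\mathcal{C})$ is the set of intersection points, i.e. points lying on at least two curves of $\mathcal{C}$. Write $\mathrm{Sing}(\mathcal{C})=\{p_1,\dots,p_s\}$. The Levi graph $G$ of $\mathcal{C}$ is the bipartite graph with vertex set $\{x_1,\dots,x_s\}\cup\{y_1,\dots,y_k\}$ in which $x_j$ and $y_i$ are joined by an edge if and only if $p_j\in C_i$. Its edge ideal $I(G)$ is the ideal generated by all $x_jy_i$ such that $x_j$ and $y_i$ are adjacent. The polynomial ring carries the standard grading. *)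

(* Defs.v *)
From HB Require Import structures.
From Stdlib Require Import ClassicalEpsilon.
From mathcomp Require Import all_boot all_order all_algebra.
From mathcomp Require Import complex reals mpoly.

Set Implicit Arguments.
Unset Strict Implicit.
Unset Printing Implicit Defensive.

Import GRing.Theory Num.Theory.

Local Open Scope ring_scope.

(* The complex projective plane over the reals R: lines through 0 in C^3. *)
Definition P2 (R : realType) := {U : {vspace 'rV[R[i]]_3} | \dim U == 1%N}.

(* A choice of homogeneous coordinates. Below they are only plugged into
   homogeneous equations, so nothing depends on the representative. *)
Definition coords (R : realType) (P : P2 R) : 'I_3 -> R[i] :=
  fun l => vpick (val P) 0 l.

Section PlaneCurves.
Variable R : realType.
Implicit Types (F : {mpoly R[i][3]}) (P Q : P2 R).

Definition on_curve F P : bool := F.@[coords P] == 0.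

Definition smooth_curve (d : nat) F : Prop :=
  [/\ F != 0, F \is d.-homog &
      forall P, on_curve F P -> exists l, F^`M(l).@[coords P] != 0].

(* Q lies on the projective tangent line at P of the curve F = 0. *)
Definition on_tangent F P Q : Prop :=
  \sum_(l < 3) F^`M(l).@[coords P] * coords Q l = 0.

Definition in_Sing k (F : 'I_k -> {mpoly R[i][3]}) P : Prop :=
  exists i j, [/\ i != j, on_curve (F i) P & on_curve (F j) P].

(* The curves through P have pairwise distinct tangent lines at P. *)
Definition ordinary_point k (F : 'I_k -> {mpoly R[i][3]}) P : Prop :=
  forall i j, i != j -> on_curve (F i) P -> on_curve (F j) P ->
    ~ (forall Q, on_tangent (F i) P Q <-> on_tangent (F j) P Q).

Record d_arrangement (d k : nat) (F : 'I_k -> {mpoly R[i][3]}) : Prop := {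
  arr_degree : (1 <= d)%N;
  arr_size : (3 <= k)%N;
  arr_smooth : forall i, smooth_curve d (F i);
  arr_distinct : forall i j, i != j ->
    ~ (forall P, on_curve (F i) P <-> on_curve (F j) P);
  arr_ordinary : forall P, in_Sing F P -> ordinary_point F P
}.

(* Vertices lshift k j (j < s) are the x_j, vertices rshift s i (i < k) are
   the y_i. *)
Definition levi_graph s k (F : 'I_k -> {mpoly R[i][3]}) (p : 'I_s -> P2 R) :
    rel 'I_(s + k) :=
  fun u v => match split u, split v with
             | inl j, inr i | inr i, inl j => on_curve (F i) (p j)
             | _, _ => false
             end.

End PlaneCurves.

Section Ideals.
Variable S : comNzRingType.

Definition ideal_gen (G : S -> Prop) : S -> Prop := fun a =>
  exists m (c g : 'I_m -> S),
    (forall i, G (g i)) /\ a = \sum_(i < m) c i * g i.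

Definition ideal_pow (I : S -> Prop) (q : nat) : S -> Prop :=
  ideal_gen (fun a =>
    exists f : 'I_q -> S, (forall i, I (f i)) /\ a = \prod_(i < q) f i).

End Ideals.

Definition edge_ideal (K : fieldType) n (e : rel 'I_n) : {mpoly K[n]} -> Prop :=
  ideal_gen (fun a => exists u v, e u v /\ a = 'X_u * 'X_v).
Arguments edge_ideal K {n} e _.

Section Regularity.
Variables (K : fieldType) (n : nat).
Local Notation S := {mpoly K[n]}.

(* A sequence of graded free modules and maps
     ... -> F_2 -> F_1 -> F_0 -> S,   F_i = \oplus_c S(- shift i c),
   each F_i of finite rank. Elements are row vectors and the maps
   F_(i+1) -> F_i, F_0 -> S are right multiplication by diff i, aug. *)
Record free_complex := FreeComplex {
  rank : nat -> nat;
  shift : forall i, 'I_(rank i) -> nat;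
  diff : forall i, 'M[S]_(rank i.+1, rank i);
  aug : 'cV[S]_(rank 0)
}.

(* The maps have degree 0 for the gradings. *)
Definition graded_complex (F : free_complex) : Prop :=
  (forall c, aug F c 0 \is (shift c).-homog) /\
  (forall i r c, diff F i r c != 0 ->
     (shift c <= shift r)%N /\ diff F i r c \is (shift r - shift c).-homog).

Definition resolves (F : free_complex) (I : S -> Prop) : Prop :=
  [/\ forall a, I a <-> exists v : 'rV_(rank F 0), a = (v *m aug F) 0 0,
      forall v : 'rV_(rank F 0),
        v *m aug F = 0 <-> exists u, v = u *m diff F 0 &
      forall i (v : 'rV_(rank F i.+1)),
        v *m diff F i = 0 <-> exists u, v = u *m diff F i.+1].

(* The image of F_(i+1) lies in (X_0, ..., X_(n-1)) F_i. *)
Definition minimal_complex (F : free_complex) : Prop :=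
  forall i r c, (diff F i r c)@_0%MM = 0.

Definition minimal_graded_free_resolution (F : free_complex) (I : S -> Prop) :=
  [/\ graded_complex F, resolves F I & minimal_complex F].

(* r = max { j - i | beta_{i,j}(I) <> 0 }, where beta_{i,j}(I) is the number of
   generators of degree j of F_i, F the minimal graded free resolution of I. *)
Definition is_regularity (I : S -> Prop) (r : int) : Prop :=
  exists F : free_complex,
    [/\ minimal_graded_free_resolution F I,
        forall i (c : 'I_(rank F i)), (shift c)%:Z - i%:Z <= r &
        exists i (c : 'I_(rank F i)), (shift c)%:Z - i%:Z = r].

(* By Hilbert's syzygy theorem and the uniqueness of minimal resolutions,
   is_regularity I determines exactly one integer for every nonzero homogeneous
   ideal I; the value is unspecified otherwise, e.g. for I = 0. *)
Definition reg (I : S -> Prop) : int := epsilon (inhabits 0) (is_regularity I).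

End Regularity.

(* Main.v *)
Require Import Defs.
From Stdlib Require Import ClassicalEpsilon.
From mathcomp Require Import all_boot all_order all_algebra.
From mathcomp Require Import boolp complex reals mpoly.
From mathcomp Require Import zify.

Set Implicit Arguments.
Unset Strict Implicit.
Unset Printing Implicit Defensive.

Import Order.TTheory GRing.Theory Num.Theory.

Local Open Scope ring_scope.

(** The Levi graph is bipartite, and one of its two sides has [k] vertices, one
    for each curve. That is all the geometry there is: for every bipartite
    graph with an edge whose side [~: W] has [k] vertices, the regularity of
    [I(G)^q] is at most [2 q + k - 1] ([reg_bipartite_edge_power]).

    The regularity is read off Koszul homology. If [0 -> N -> F -> M -> 0] is
    a minimal graded presentation, vanishing of the Koszul homology
    [H_(i+1)(M)_j] forces that of [H_i(N)_j] ([koszul_exact_syzygy]). Hence, if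
    [H_i(I)_j = 0] whenever [j >= i + b], then the i-th syzygy module of [I] is
    generated in degrees smaller than [i + b]. This bounds the shifts of any
    minimal resolution, and it also shows that each syzygy module is finitely
    generated, so that a minimal resolution exists ([reg_bound]).

    The ideal [I(G)^q] is monomial, so its Koszul complex splits into strands
    indexed by the monomials [m]. The strand of [m] is a complex on the sets
    [A] of variables such that [m / prod_(l in A) x_l] lies in [I(G)^q], and
    this last condition says that a flow of total amount [q] along the edges
    of the graph fits under the exponent vector. It remains to show that the
    strand of [m] is exact at sets of size [i] if [deg m >= i + 2 q + k]
    ([exact_at_flow]).

    Freeze the part [tau] of [A] outside [W]. The fiber thus obtained is a
    Koszul strand of the ideal generated by the margins on [W] of the flows of
    amount [q] with bounded margins on the other side. These margins satisfy a
    polymatroidal exchange property ([flow_exchange]); in decreasing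
    lexicographic order they have linear quotients, and so all Koszul homology
    of the fiber sits in its top degree ([exact_at_linear_quotients]). When all
    fibers are exact in the relevant degree, so is the whole strand
    ([exact_at_total]).

    Finally, both sides of the bipartition are needed. If [m] has degree less
    than [q + k] in the [k] variables outside [W], its degree in the variables
    of [W] exceeds [i + q], and the fibers over subsets of [~: W] are exact at
    size [i]. Otherwise the fibers over subsets of [W] are exact at every size:
    homology could survive only at sets containing at least [k] of the
    variables outside [W], that is all of them, and a cycle concentrated on
    such a full set vanishes. *)

(** * Signed boundary operators on functions of finite sets *)

Section Chains.
Variable n : nat.
Implicit Types (A B W : {set 'I_n}) (l t : 'I_n).

Definition ksign l A : nat := #|[set t in A | (t < l)%N]|.

Lemma ksignU l t A : t \notin A -> ksign l (t |: A) = (ksign l A + (t < l))%N.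
Proof.
move=> tA; rewrite /ksign; case: (boolP (t < l)%N) => tl.
  have -> : [set x in t |: A | (x < l)%N] = t |: [set x in A | (x < l)%N].
    apply/setP => x; rewrite !inE andb_orl; congr orb.
    by case: eqP => // ->; rewrite tl.
  by rewrite cardsU1 !inE (negbTE tA) addnC.
rewrite addn0; congr #|pred_of_set _|; apply/setP => x; rewrite !inE andb_orl.
by case: eqP => // ->; rewrite (negbTE tl) andbF.
Qed.

(** Inserting [l] and [t] in the two possible orders gives opposite signs; this
    makes the boundary square to zero and makes [cone] a homotopy. *)
Lemma ksign_swap l t A : l \notin A -> t \notin A -> l != t ->
  (ksign l (t |: A) + ksign t (l |: A) = (ksign l A + ksign t A).+1)%N.
Proof.
move=> lA tA lt; rewrite !ksignU //.
have : (l : nat) != t by [].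
by case: ltngtP => //=; lia.
Qed.

Section Boundary.
Variables (R : comNzRingType) (V : lmodType R).
Implicit Types (c : 'I_n -> R) (f g : {set 'I_n} -> V).

(** With [W] the set of all variables and [c l = 'X_l] this is the Koszul
    differential. With [c = 1] it is the simplicial one, where [f] is a
    chain and [f A] its coefficient at the face [A]. Smaller sets [W] give the
    partial differentials of a double complex. *)
Definition boundary c W f A : V :=
  \sum_(l | (l \in W) && (l \notin A)) ((-1) ^+ ksign l A * c l) *: f (l |: A).

Lemma eq_boundary c W f g : f =1 g -> boundary c W f =1 boundary c W g.
Proof. by move=> fg A; apply: eq_bigr => l _; rewrite fg. Qed.

Lemma boundary0 c W f A : (forall l, f (l |: A) = 0) -> boundary c W f A = 0.
Proof. by move=> f0; rewrite /boundary big1 // => l _; rewrite f0 scaler0. Qed.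

Lemma boundaryB c W f g A :
  boundary c W (fun B => f B - g B) A = boundary c W f A - boundary c W g A.
Proof. by rewrite -sumrB; apply: eq_bigr => l _; rewrite scalerBr. Qed.

Lemma boundaryD c W f g A :
  boundary c W (fun B => f B + g B) A = boundary c W f A + boundary c W g A.
Proof. by rewrite -big_split; apply: eq_bigr => l _; rewrite scalerDr. Qed.

Lemma boundary_setT c W f A :
  boundary c setT f A = boundary c W f A + boundary c (~: W) f A.
Proof.
rewrite /boundary (bigID (mem W)) /=.
by congr (_ + _); apply: eq_bigl => l; rewrite !inE andbC.
Qed.

(** Pairing [(l, t)] with [(t, l)] proves this in every characteristic, while
    showing that the sum equals its opposite would not suffice. *)
Lemma sum_antisym (F : 'I_n -> 'I_n -> V) :
  (forall l, F l l = 0) -> (forall l t, F l t = - F t l) ->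
  \sum_l \sum_t F l t = 0.
Proof.
move=> F0 FN.
have -> : \sum_l \sum_t F l t =
    \sum_(l < n) \sum_(t < n | (t < l)%N) F l t
    + \sum_(l < n) \sum_(t < n | (l < t)%N) F l t.
  rewrite -big_split; apply: eq_bigr => l _ /=.
  rewrite (bigID (fun t : 'I_n => (t < l)%N)) /=; congr (_ + _).
  rewrite (bigD1 l) ?ltnn //= F0 add0r; apply: eq_bigl => t.
  by rewrite -leqNgt [RHS]ltn_neqAle andbC eq_sym.
rewrite [X in _ + X](exchange_big_dep xpredT) //= -big_split big1 // => l _ /=.
by rewrite -big_split big1 // => t _ /=; rewrite FN addNr.
Qed.

Lemma boundaryK c W f A : boundary c W (boundary c W f) A = 0.
Proof.
pose F l t := if [&& l \in W, l \notin A, t \in W, t \notin A & t != l]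
  then ((-1) ^+ ksign l A * c l * ((-1) ^+ ksign t (l |: A) * c t))
         *: f (t |: (l |: A)) else 0.
rewrite -[RHS](@sum_antisym F) /F.
- rewrite /boundary big_mkcond; apply: eq_bigr => l _.
  case: (boolP (l \in W)) => lW /=; last by rewrite big1.
  case: (boolP (l \in A)) => lA /=; first by rewrite big1.
  rewrite scaler_sumr big_mkcond; apply: eq_bigr => t _.
  by rewrite !inE negb_or [_ && (t != l)]andbC; case: ifP;
     rewrite ?scalerA.
- by move=> l; rewrite eqxx !andbF.
move=> l t; rewrite eq_sym.
case: (boolP (l \in W)) => lW; case: (boolP (l \in A)) => lA;
case: (boolP (t \in W)) => tW; case: (boolP (t \in A)) => tA /=;
 rewrite ?oppr0 //.
case: (boolP (l != t)) => lt /=; last by rewrite oppr0.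
rewrite setUCA -scaleNr; congr (_ *: _).
rewrite !mulrA ![_ * c _ * _ ^+ _]mulrAC -!mulrA -mulrN.
rewrite [c t * c l]mulrC mulrN !(mulrA _ _ (c l * _)) -!exprD -mulNr.
congr (_ * _); rewrite !ksignU // (addnCA (ksign t A)).
have : (l : nat) != t by [].
by case: ltngtP => // _ _; rewrite ?addn0 ?addn1 !addnS exprS mulN1r ?opprK.
Qed.

End Boundary.

Section Cone.
Variables (R : comNzRingType) (V : lmodType R).
Implicit Types (f g : {set 'I_n} -> V).

(** The contraction of a simplex towards its vertex [t]. *)
Definition cone t f A : V :=
  if t \in A then (-1) ^+ ksign t (A :\ t) *: f (A :\ t) else 0.

Lemma boundary_cone W t f A : t \in W ->
  boundary (fun=> 1 : R) W (cone t f) A + cone t (boundary (fun=> 1 : R) W f) A = f A.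
Proof.
move=> tW; case: (boolP (t \in A)) => tA; last first.
  rewrite [cone _ _ A]/cone (negbTE tA) addr0.
  rewrite /boundary (bigD1 t) /= ?tW // big1 ?addr0 => [|l /andP[_ lt]].
    rewrite /cone setU11 setU1K // mulr1 scalerA -exprD addnn -mul2n exprM.
    by rewrite sqrrN !expr1n scale1r.
  by rewrite /cone !inE (negbTE tA) eq_sym (negbTE lt) scaler0.
have [B tB ->] : exists2 B : {set 'I_n}, t \notin B & A = t |: B.
  by exists (A :\ t); rewrite ?setD1K // !inE eqxx.
rewrite [cone _ _ _]/cone setU11 setU1K // {2}/boundary (bigD1 t) /= ?tW //.
rewrite scalerDr scalerA mulr1 -exprD addnn -mul2n exprM sqrrN !expr1n scale1r.
rewrite addrCA scaler_sumr /boundary.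
under [X in _ + (_ + X)]eq_bigl do
  rewrite -andbA [_ && (_ != t)]andbC -negb_or -in_setU1.
rewrite -big_split big1 ?addr0 //= => l /andP[_].
rewrite !inE negb_or => /andP[lt lB].
rewrite /cone setUCA setU11 setU1K; last by rewrite !inE eq_sym negb_or lt.
rewrite !mulr1 !scalerA -scalerDl -!exprD [(ksign l _ + _)%N]ksign_swap //.
by rewrite addnC exprS mulN1r addNr scale0r.
Qed.

End Cone.
End Chains.

(** * Exactness from the fibers of a double complex *)

Section Exactness.
Variables (n : nat) (R : comNzRingType) (V : lmodType R).
Implicit Types (A B W tau : {set 'I_n}) (l t : 'I_n) (D : {set 'I_n} -> Prop).
Implicit Types (f g : {set 'I_n} -> V).

Definition supported D i f := forall A, f A != 0 -> D A /\ #|A| = i.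

Local Notation bd := (@boundary n R V (fun=> 1)).

Definition exact_at W D i := forall f,
  supported D i f -> (forall A, bd W f A = 0) ->
  exists2 g, supported D i.+1 g & forall A, f A = bd W g A.

Lemma eq_exact_at W D D' i :
  (forall A, D A <-> D' A) -> exact_at W D i -> exact_at W D' i.
Proof.
move=> DD' ex f sf cf; have [|g sg fg] := ex f _ cf.
  by move=> A /sf[/DD'].
by exists g => // A /sg[/DD'].
Qed.

Lemma supported_boundary W D i g :
  (forall l A, D (l |: A) -> D A) -> supported D i.+1 g ->
  supported D i (bd W g).
Proof.
move=> Ddown sg A nz.
have [l /andP[_ lA] gl] : exists2 l, (l \in W) && (l \notin A) & g (l |: A) != 0.
  apply: contraNP nz => no; rewrite /boundary big1 // => l lWA.
  by case: (eqVneq (g (l |: A)) 0) => [->|gl]; [rewrite scaler0|case: no; exists l].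
by have [/Ddown DA] := sg _ gl; rewrite cardsU1 lA => -[].
Qed.

Lemma fiber_setU1 W l A : l \in W -> (l |: A) :\: W = A :\: W.
Proof.
by move=> lW; apply/setP => x; rewrite !inE; case: eqP => // ->; rewrite lW.
Qed.

Lemma fiber_setU1N W l A : l \notin W -> l \notin A ->
  #|(l |: A) :\: W| = #|A :\: W|.+1.
Proof.
move=> lW lA; rewrite setDUl (setDidPl _).
  by rewrite cardsU1 !inE lW (negbTE lA).
by rewrite disjoints1.
Qed.

(** The argument of the spectral sequence of a double complex: a cycle is
    corrected by boundaries so as to lower the size of [A :\: W], one layer at
    a time. On the top layer only the [W] part of the differential acts, so
    the fibers there see a cycle. *)
Lemma exact_at_total W D i :
  (forall l A, D (l |: A) -> D A) ->
  (forall tau, exact_at W (fun A => D A /\ A :\: W = tau) i) ->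
  exact_at setT D i.
Proof.
move=> Ddown ex f sf cf.
have [p] : exists p, forall A, f A != 0 -> (#|A :\: W| < p)%N.
  by exists n.+1 => A _; rewrite ltnS -[X in (_ <= X)%N]card_ord max_card.
elim: p f sf cf => [|p IH] f sf cf small.
  exists (fun=> 0) => [A|A]; first by rewrite eqxx.
  rewrite boundary0 //; apply/eqP; case: eqP => // /eqP /small //.
(* The part of f over tau; only the layer #|tau| = p is used. *)
pose ft tau A := if A :\: W == tau then f A else 0.
have /choice[G HG] tau : exists g, #|tau| = p ->
    supported (fun A => D A /\ A :\: W = tau) i.+1 g /\
      forall A, ft tau A = bd W g A.
  case: (eqVneq #|tau| p) => [tp|/eqP tp]; last by exists (fun=> 0).
  have [|A|g sg fg] := ex tau (ft tau); last by exists g.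
    by move=> A; rewrite /ft; case: (A :\: W =P tau) => [<- /sf[]|]; rewrite ?eqxx.
  case: (eqVneq (A :\: W) tau) => [At|/negbTE At]; last first.
    rewrite /boundary big1 // => l /andP[lW _].
    by rewrite /ft fiber_setU1 // At scaler0.
  transitivity (bd W f A).
    by apply: eq_bigr => l /andP[lW _]; rewrite /ft fiber_setU1 // At eqxx.
  have := cf A; rewrite (boundary_setT _ W) [X in _ + X]/boundary big1 ?addr0 // => l.
  rewrite inE => /andP[lW lA]; case: (eqVneq (f (l |: A)) 0) => [->|/small].
    by rewrite scaler0.
  by rewrite fiber_setU1N // At tp ltnn.
pose g A := if #|A :\: W| == p then G (A :\: W) A else 0.
have sg : supported D i.+1 g.
  move=> A; rewrite /g; case: (#|A :\: W| =P p) => [Ap|]; rewrite ?eqxx //.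
  by have [sG _] := HG _ Ap; move=> /sG [[]].
have bdW A : bd W g A = if #|A :\: W| == p then f A else 0.
  transitivity (if #|A :\: W| == p then bd W (G (A :\: W)) A else 0).
    case: ifP => Ap.
      by apply: eq_bigr => l /andP[lW _]; rewrite /g fiber_setU1 // Ap.
    rewrite /boundary big1 // => l /andP[lW _].
    by rewrite /g fiber_setU1 // Ap scaler0.
  by case: eqP => // Ap; have [_ <-] := HG _ Ap; rewrite /ft eqxx.
(* The rest of the differential maps the top layer strictly below it. *)
have bdC A : (p <= #|A :\: W|)%N -> bd (~: W) g A = 0.
  move=> pA; rewrite /boundary big1 // => l; rewrite inE => /andP[lW lA].
  by rewrite /g fiber_setU1N // gtn_eqF ?scaler0.
have sbg := @supported_boundary setT D i g Ddown sg.
have [|A|A|h sh fh] := IH (fun A => f A - bd setT g A).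
- move=> A; case: (eqVneq (bd setT g A) 0) => [->|/sbg //].
  by rewrite subr0 => /sf.
- by rewrite boundaryB boundaryK subr0.
- rewrite (boundary_setT _ W) bdW; case: (ltngtP #|A :\: W| p) => // [pA|Ap].
    rewrite bdC 1?ltnW // addr0 subr0 => /small.
    by rewrite ltnS leqNgt pA.
  by rewrite bdC ?Ap // addr0 subrr eqxx.
exists (fun A => g A + h A) => [A|A].
  by case: (eqVneq (g A) 0) => [->|/sg //]; rewrite add0r => /sh.
by rewrite boundaryD -fh addrC subrK.
Qed.

End Exactness.

(** * Linear quotients *)

Section LinearQuotients.
Variables (n : nat) (R : comNzRingType) (V : lmodType R).
Variables (W tau : {set 'I_n}) (m : 'X_{1..n}).
Implicit Types (A B : {set 'I_n}) (l t b : 'I_n) (v w : 'X_{1..n}).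
Implicit Types (f g : {set 'I_n} -> V) (L : seq 'X_{1..n}).

(** With [v] the exponent vector of a generator, restricted to [W], this says
    that the monomial of [v] divides [m] over the monomial of [A]. *)
Definition fits v A : bool := [forall l in W, (v l + (l \in A) <= m l)%N].

Definition fiber_complex L A : bool := (A :\: W == tau) && has (fits^~ A) L.

(** The variable [b] belongs to the colon ideal [(L : v)], in the form that occurs
    for generators of equal degree: some [w] in [L] divides [x_b v]. *)
Definition colon_var L v b : bool :=
  has (fun w => [forall l in W, (w l <= v l + (l == b))%N]) L.

(** For each generator [v], the colon by [v] of the ideal of its predecessors is
    generated by variables. *)
Definition linear_quotients L : Prop := forall L1 v L2, L = L1 ++ v :: L2 ->
  forall w, w \in L1 -> exists2 b, b \in W & (v b < w b)%N && colon_var L1 v b.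

Local Notation bd := (@boundary n R V (fun=> 1)).

Lemma fits_setU v l A : fits v (l |: A) -> fits v A.
Proof.
move=> /forall_inP fA; apply/forall_inP => x xW; apply: leq_trans (fA x xW).
by rewrite leq_add2l !inE; case: (x \in A); rewrite ?orbT.
Qed.

Lemma fiber_complex_setU L l A :
  l \in W -> fiber_complex L (l |: A) -> fiber_complex L A.
Proof.
move=> lW /andP[tA /hasP[v vL vA]]; rewrite /fiber_complex.
rewrite -(fiber_setU1 A lW) tA; apply/hasP; exists v => //.
exact: fits_setU vA.
Qed.

Lemma fiber_complex_rcons L v A :
  fiber_complex (rcons L v) A = fiber_complex L A || (A :\: W == tau) && fits v A.
Proof. by rewrite /fiber_complex has_rcons andb_orr orbC. Qed.

Lemma linear_quotients_rcons L v :
  linear_quotients (rcons L v) -> linear_quotients L /\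
  forall w, w \in L -> exists2 b, b \in W & (v b < w b)%N && colon_var L v b.
Proof.
move=> lq; split; last by apply: (lq L v [::]); rewrite cats1.
by move=> L1 w L2 LE; apply: (lq L1 w (rcons L2 v)); rewrite LE rcons_cat.
Qed.

(** The monomials of [v S] that belong to the ideal of [L] include all
    multiples of [x_b v] for the colon variables [b]. *)
Lemma fits_colon L v b A : (A :\: W == tau) ->
  colon_var L v b -> fits v A -> (v b + 1 + (b \in A) <= m b)%N ->
  fiber_complex L A.
Proof.
move=> tA /hasP[w wL /forall_inP wv] /forall_inP vA bm.
rewrite /fiber_complex tA; apply/hasP; exists w => //; apply/forall_inP => l lW.
apply: leq_trans (leq_add (wv l lW) (leqnn _)) _.
by case: eqP => [->|_] //=; rewrite addn0; apply: vA.
Qed.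

(** Adding a generator [v] to the ideal [J] of its predecessors adds to the
    strand a relative complex, that of [S / (J : v)] up to a shift. As [J : v]
    is generated by variables, that complex is a cone, hence acyclic, as soon
    as some variable outside [J : v] still divides [m / v]; otherwise it
    consists of the single set of all variables dividing [m / v], whose size
    is the degree of [m / v]. Here all monomials are in the variables of [W]. *)
Lemma exact_at_linear_quotients q i L :
  linear_quotients L -> (forall v, v \in L -> \sum_(l in W) v l = q)%N ->
  (i + q < \sum_(l in W) m l + #|tau|)%N ->
  exact_at V W (fiber_complex L) i.
Proof.
elim/last_ind: L => [|L v IH] lq wt iq f sf cf.
  exists (fun=> 0) => [A|A]; first by rewrite eqxx.
  rewrite boundary0 //; apply/eqP; apply: contraTT isT => /sf[].
  by rewrite /fiber_complex andbF.
have {lq} [lq lqv] := linear_quotients_rcons lq.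
have {}IH := IH lq (fun w wL => wt w (ltac:(by rewrite mem_rcons inE wL orbT))) iq.
have sub A : fiber_complex L A -> fiber_complex (rcons L v) A.
  by rewrite fiber_complex_rcons => ->.
have [t /andP[/andP[tW vt] tT]|full] :=
    pickP (fun t => [&& t \in W & v t < m t]%N && ~~ colon_var L v t); last first.
  have [|//|g sg fg] := IH f; last by exists g => // A /sg[/sub].
  move=> A fA; have [] := sf A fA; rewrite fiber_complex_rcons.
  case: (boolP (fiber_complex L A)) => //= LA /andP[tA vA] Ai; exfalso.
  (* Without a cone point, v and a set A of the relative complex together
   fill m on W, which makes A too large. *)
  have vm l : l \in W -> (v l + (l \in A))%N = m l.
    move=> lW; have vl := forall_inP vA l lW; apply/eqP; rewrite eqn_leq vl /=.
    rewrite leqNgt; apply/negP => ml; move: (full l); rewrite lW /=.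
    have -> : (v l < m l)%N by apply: leq_ltn_trans (leq_addr _ _) ml.
    move=> /negbFE lT; case/negP: LA; apply: (fits_colon tA lT vA).
    by rewrite addnAC addn1.
  move: iq; rewrite -(eq_bigr _ vm) big_split /= wt ?mem_rcons ?inE ?eqxx //.
  have -> : (\sum_(l in W) (l \in A) = #|A :&: W|)%N.
    rewrite -sum1_card big_mkcond [RHS]big_mkcond; apply: eq_bigr => l _.
    by rewrite inE andbC; do 2!case: (_ \in _).
  have := cardsID W A; rewrite (eqP tA) Ai => <-.
  by rewrite [X in (X < _)%N]addnC addnA ltnn.
(* The relative part of f, which the cone over t bounds. *)
pose f' A := if fiber_complex L A then 0 else f A.
have f'f A : f' A != 0 -> ~~ fiber_complex L A /\ f A != 0.
  by rewrite /f'; case: ifP => //; rewrite ?eqxx.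
have f'v A : f' A != 0 -> (A :\: W == tau) && fits v A.
  by move=> /f'f[LA /sf[]]; rewrite fiber_complex_rcons (negbTE LA).
pose g := cone t f'.
have gP A : g A != 0 -> t \in A /\ f' (A :\ t) != 0.
  rewrite /g /cone; case: ifP => // _; rewrite ?eqxx //.
  by move=> nz; split => //; apply: contraNneq nz => ->; rewrite scaler0.
have fitst A : t \in A -> fits v (A :\ t) -> fits v A.
  move=> tA /forall_inP vA; apply/forall_inP => l lW.
  case: (eqVneq l t) => [->|lt]; first by rewrite tA addn1.
  by have := vA l lW; rewrite !inE lt.
have fibt A : (A :\ t) :\: W = A :\: W.
  by apply/setP => x; rewrite !inE; case: eqP => // ->; rewrite tW.
have sg : supported (fiber_complex (rcons L v)) i.+1 g.
  move=> A /gP[tA f'A]; have /andP[] := f'v _ f'A; rewrite fibt => At vA.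
  have [_ /sf[_ Ai]] := f'f _ f'A.
  by rewrite fiber_complex_rcons At fitst ?orbT // (cardsD1 t) tA Ai.
have [|A|h sh fh] := IH (fun A => f A - bd W g A).
- move=> A nz.
  have cardA : #|A| = i.
    apply/eqP; apply: contraTT nz => Ai; rewrite negbK.
    have -> : f A = 0 by apply/eqP; apply: contraNT Ai => /sf[_ ->].
    rewrite sub0r oppr_eq0; apply/eqP; rewrite /boundary big1 // => l /andP[_ lA].
    suff -> : g (l |: A) = 0 by rewrite scaler0.
    apply/eqP; apply: contraNT Ai => /sg[_].
    by rewrite cardsU1 lA add1n => -[->]; exact: eqxx.
  split=> //; apply: contraTT nz => LA; rewrite negbK.
  have := boundary_cone f' A tW; rewrite -/g {2}/f' (negbTE LA) => <-.
  rewrite addrAC subrr add0r /cone; case: ifP => // tA.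
  suff -> : bd W f' (A :\ t) = 0 by rewrite scaler0.
  case: (boolP (fiber_complex L (A :\ t))) => LB; last first.
    rewrite -[RHS](cf (A :\ t)); apply: eq_bigr => l /andP[lW _].
    rewrite /f' ifN //; apply: contra LB; exact: fiber_complex_setU.
  rewrite /boundary big1 // => l /andP[lW lB].
  suff -> : f' (l |: A :\ t) = 0 by rewrite scaler0.
  apply/eqP; apply: contraNT LA => /f'v /andP[].
  rewrite fiber_setU1 // fibt => At /fits_setU vB.
  have /andP[_ /hasP[w wL wB]] := LB.
  have [b bW /andP[vb bT]] := lqv w wL.
  have bt : b != t by apply: contraNneq tT => <-.
  apply: (fits_colon At bT); first exact: fitst.
  have := forall_inP wB b bW; rewrite !inE bt /=; apply: leq_trans.
  by rewrite leq_add2r addn1.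
- by rewrite boundaryB boundaryK subr0.
exists (fun A => g A + h A) => [A|A].
  by case: (eqVneq (g A) 0) => [->|/sg //]; rewrite add0r => /sh[/sub].
by rewrite boundaryD -fh addrC subrK.
Qed.

End LinearQuotients.

(** * Flows in bipartite graphs and their exchange property *)

Lemma sum_indicator (I : finType) (P : pred I) (i : I) :
  (\sum_(j | P j) (j == i) = P i)%N.
Proof.
rewrite big_mkcond (bigD1 i) //= eqxx big1 ?addn0 => [|j /negbTE ->].
  by case: (P i).
by case: ifP.
Qed.

Lemma ltn_sum_exists (I : finType) (P : pred I) (F G : I -> nat) :
  (\sum_(i | P i) F i < \sum_(i | P i) G i)%N -> exists2 i, P i & (F i < G i)%N.
Proof.
move=> lt; have [i /andP[Pi Fi]|no] := pickP (fun i => P i && (F i < G i)%N).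
  by exists i.
move: lt; rewrite ltnNge; case/negP; apply: leq_sum => i Pi.
by have := no i; rewrite Pi /= ltnNge => /negbFE.
Qed.

Lemma leq_sum_exists (I : finType) (P : pred I) (F G : I -> nat) i0 :
  P i0 -> (F i0 < G i0)%N -> (\sum_(i | P i) G i <= \sum_(i | P i) F i)%N ->
  exists2 i, P i & (G i < F i)%N.
Proof.
move=> Pi0 lt0 le; have [i /andP[Pi Fi]|no] := pickP (fun i => P i && (G i < F i)%N).
  by exists i.
move: le; rewrite (bigD1 i0) //= [X in (_ <= X)%N](bigD1 i0) //=.
rewrite leqNgt; case/negP; rewrite -addSn; apply: leq_add => //.
apply: leq_sum => i /andP[Pi _].
by have := no i; rewrite Pi /= ltnNge => /negbFE.
Qed.

Section Flows.
Variables (n : nat) (W : {set 'I_n}) (E : rel 'I_n).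
Hypothesis E_bip : forall u v, E u v -> u \in W /\ v \notin W.
Implicit Types (z : 'I_n * 'I_n -> nat) (x p : 'I_n * 'I_n) (l a b y : 'I_n).

Definition row_sum z l : nat := (\sum_(x | x.1 == l) z x)%N.
Definition col_sum z l : nat := (\sum_(x | x.2 == l) z x)%N.

Definition flow (q : nat) z : Prop :=
  (forall x, 0 < z x -> E x.1 x.2)%N /\ (\sum_x z x)%N = q.

Definition reroute z p p' x : nat := z x + (x == p) - (x == p').

(** Stated for every set of edges [P], so that it gives the row sums, the column
    sums and the total at once. *)
Lemma sum_reroute (P : pred ('I_n * 'I_n)) z p p' : (0 < z p')%N ->
  (\sum_(x | P x) reroute z p p' x + P p' = \sum_(x | P x) z x + P p)%N.
Proof.
move=> zp; rewrite -[in LHS](sum_indicator P p') -[in RHS](sum_indicator P p).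
rewrite -!big_split.
apply: eq_bigr => x _; rewrite /reroute /= subnK //.
by case: (x =P p') => // ->; apply: leq_trans (leq_addr _ _).
Qed.

Lemma total_row_sum z : (\sum_x z x = \sum_l row_sum z l)%N.
Proof. by rewrite (partition_big (fun x => x.1) xpredT). Qed.

Lemma row_sum_out q z l : flow q z -> l \notin W -> row_sum z l = 0%N.
Proof.
move=> [zE _] lW; apply: big1 => x /eqP xl; apply/eqP; rewrite -leqn0 leqNgt.
by apply/negP => /zE /E_bip[]; rewrite xl (negbTE lW).
Qed.

Lemma col_sum_in q z l : flow q z -> l \in W -> col_sum z l = 0%N.
Proof.
move=> [zE _] lW; apply: big1 => x /eqP xl; apply/eqP; rewrite -leqn0 leqNgt.
by apply/negP => /zE /E_bip[_]; rewrite xl lW.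
Qed.

Variables (m : 'X_{1..n}) (tau : {set 'I_n}).

Definition capacitated z : Prop :=
  forall y, y \notin W -> (col_sum z y + (y \in tau) <= m y)%N.

Lemma flow_reroute q z p p' : flow q z -> (0 < z p')%N -> E p.1 p.2 ->
  flow q (reroute z p p').
Proof.
move=> [zE zq] zp' Ep; split.
  move=> x; rewrite /reroute; case: (x =P p) => [-> //|_].
  by rewrite addn0 => zx; apply: zE; apply: leq_trans zx (leq_subr _ _).
by apply/(@addIn 1); rewrite (sum_reroute xpredT) // zq.
Qed.

(** The row sums of the flows form the bases of a polymatroid. Starting from the
    deficient row [b], put one more unit on an edge [(b, i)] on which [z'] is
    larger than [z]. If column [i] has room, take the unit away from any row
    where [z] exceeds [z']. If it has none, [z] exceeds [z'] at another entry
    [(a, i)] of that column, from which the unit is taken; then either [a]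
    is the row sought, or [a] is the new deficient row, and the distance
    between the two flows has decreased. *)
Lemma flow_exchange q z z' b :
  flow q z -> capacitated z -> flow q z' -> capacitated z' ->
  (row_sum z b < row_sum z' b)%N ->
  exists a z'', [/\ (row_sum z' a < row_sum z a)%N, flow q z'', capacitated z''
    & forall l, (row_sum z'' l + (a == l) = row_sum z l + (b == l))%N].
Proof.
have [d] := ubnP (\sum_x (z' x - z x))%N; elim: d z b => // d IH z b.
rewrite ltnS => dist fz cz fz' cz' zb.
have [[b' i] /= /eqP -> {b'} zi] := ltn_sum_exists zb.
have Ebi : E b i by have [zE _] := fz'; apply: (zE (b, i)); apply: leq_ltn_trans zi.
have [bW iW] := E_bip Ebi.
have row_rr a y : (0 < z (a, y))%N -> forall l,
    (row_sum (reroute z (b, i) (a, y)) l + (a == l) = row_sum z l + (b == l))%N.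
  by move=> zay l; apply: (sum_reroute (fun x => x.1 == l)).
have col_rr a y : (0 < z (a, y))%N -> forall l,
    (col_sum (reroute z (b, i) (a, y)) l + (y == l) = col_sum z l + (i == l))%N.
  by move=> zay l; apply: (sum_reroute (fun x => x.2 == l)).
have [room|tight] := ltnP (col_sum z i + (i \in tau)) (m i).
  have [a _ za] : exists2 a, xpredT a & (row_sum z' a < row_sum z a)%N.
    apply: (@leq_sum_exists _ xpredT _ _ b) => //.
    by rewrite -!total_row_sum; case: fz => _ ->; case: fz' => _ ->.
  have [|[a' y] /= /eqP -> {a'} zay] :=
      @ltn_sum_exists _ (fun x => x.1 == a) (fun=> 0%N) z.
    by rewrite big1 // (leq_ltn_trans _ za).
  exists a, (reroute z (b, i) (a, y)); split=> //; first exact: flow_reroute.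
    move=> c cW; have := col_rr a y zay c; have := cz c cW.
    by case: (i =P c) => [<-|_] /=; move: room; lia.
  exact: row_rr.
have [|[a y] /= /eqP -> {y} zai] :=
    @leq_sum_exists _ (fun x => x.2 == i) z z' (b, i) (eqxx _) zi.
  by have := cz' i iW; rewrite -/(col_sum z i) -/(col_sum z' i); lia.
have zai0 : (0 < z (a, i))%N by apply: leq_ltn_trans zai.
pose z1 := reroute z (b, i) (a, i).
have fz1 : flow q z1 by apply: flow_reroute.
have cz1 : capacitated z1.
  by move=> c cW; rewrite (addIn (col_rr a i zai0 c)); apply: cz.
have rz1 := row_rr a i zai0; rewrite -/z1 in rz1.
have [za|za] := ltnP (row_sum z' a) (row_sum z a); first by exists a, z1.
have ab : a != b by apply/eqP => ab; move: zai; rewrite ab; lia.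
have [| //|//|//|//| |c [z'' [z'c fz'' cz'' rz'']]] := IH z1 a.
- apply: leq_trans dist; rewrite (bigD1 (b, i)) //= [X in (_ < X)%N](bigD1 (b, i)) //=.
  rewrite -addSn; apply: leq_add.
    rewrite /z1 /reroute eqxx xpair_eqE [b == a]eq_sym (negbTE ab) /=; lia.
  apply: leq_sum => x xb; rewrite /z1 /reroute (negbTE xb).
  by case: (x =P (a, i)) => [->|] /=; lia.
- have := rz1 a; rewrite eqxx [b == a]eq_sym (negbTE ab); lia.
exists c, z''; split=> //; last by move=> l; rewrite rz'' rz1.
have := rz1 c; case: (b =P c) => [bc|_]; last by lia.
by move: z'c; rewrite -bc; have := rz1 b; rewrite eqxx (negbTE ab); lia.
Qed.

End Flows.

(** * Exactness of the strands of a power of an edge ideal *)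

Section Polymatroid.
Variables (n : nat) (W : {set 'I_n}) (E : rel 'I_n).
Hypothesis E_bip : forall u v, E u v -> u \in W /\ v \notin W.
Variables (q : nat) (m : 'X_{1..n}).
Implicit Types (tau A : {set 'I_n}) (v w : 'X_{1..n}) (L : seq 'X_{1..n}).

(** The strand at [m]: the sets [A] such that [m] divided by the product of the
    variables in [A] lies in the q-th power of the edge ideal. *)
Definition flow_complex A : Prop := exists2 z, flow E q z &
  forall l, (row_sum z l + col_sum z l + (l \in A) <= m l)%N.

(** The generators of the ideal whose strand is the fiber over [tau]: margins
    on [W] of the flows which leave room for [tau] on the other side. *)
Definition flow_vector tau v : Prop := exists z,
  [/\ flow E q z, capacitated W m tau z & forall l, row_sum z l = v l].

Lemma flow_vector_mdeg tau v : flow_vector tau v -> mdeg v = q.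
Proof.
move=> [z [[_ zq] _ zv]]; rewrite mdegE -zq total_row_sum.
by apply: eq_bigr => l _; rewrite zv.
Qed.

Lemma flow_vector_enum tau : exists L, [/\ sorted >=%O L, uniq L &
  forall v, v \in L <-> flow_vector tau v].
Proof.
pose s := [seq bmnm t |
  t <- enum {: 'X_{1..n < q.+1}} & `[< flow_vector tau (bmnm t) >]].
exists (sort >=%O s); split.
- by apply: sort_sorted => x y; apply: ge_total.
- rewrite sort_uniq map_inj_uniq; first by rewrite filter_uniq ?enum_uniq.
  by move=> x y xy; apply/eqP; rewrite bmeqP xy.
move=> v; rewrite mem_sort; split=> [/mapP[w]|vB].
  by rewrite mem_filter => /andP[/asboolP wB _] ->.
have vq : (mdeg v < q.+1)%N by rewrite (flow_vector_mdeg vB).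
apply/mapP; exists (BMultinom vq) => //; rewrite mem_filter mem_enum.
by apply/andP; split=> //; apply/asboolP.
Qed.

(** If [w] precedes [v] and [b] is the first place where they differ, exchange
    yields [v + e_b - e_a]; as [a] comes after [b], this vector also precedes
    [v], and so [x_b] is a colon variable. *)
Lemma linear_quotients_flow tau L :
  sorted >=%O L -> uniq L -> (forall v, v \in L <-> flow_vector tau v) ->
  linear_quotients W L.
Proof.
move=> sL uL LB L1 v L2 LE w wL1.
have ge_tr : transitive (>=%O : rel 'X_{1..n}) by move=> x y z /[swap]; apply: le_trans.
have vL : v \in L by rewrite LE mem_cat inE eqxx orbT.
have wL : w \in L by rewrite LE mem_cat wL1.
move: sL; rewrite (sorted_pairwise ge_tr) LE pairwise_cat => /and3P[/allrelP r12 _].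
rewrite /= => /andP[/allP vL2 _].
have wv : (v < w)%O.
  have vw : (v <= w)%O by apply: (r12 w v); rewrite ?inE ?eqxx.
  rewrite lt_neqAle vw andbT; apply: contraL uL => /eqP {}vw.
  by rewrite LE cat_uniq; apply/nandP; right; apply/nandP; left;
     rewrite negbK; apply/hasP; exists v; rewrite ?inE ?eqxx //= vw.
have [z [fz cz zv]] := (LB v).1 vL; have [z' [fz' cz' zw]] := (LB w).1 wL.
have degv := flow_vector_mdeg ((LB v).1 vL).
have degw := flow_vector_mdeg ((LB w).1 wL).
have [b vw_eq vb] := ltmcP (etrans degv (esym degw)) wv.
have [|a [z'' [z'a fz'' cz'' rz'']]] := flow_exchange E_bip fz cz fz' cz' (b := b).
  by rewrite zv zw.
exists b.
  by apply: contraLR vb => bW; rewrite -zw (row_sum_out E_bip fz' bW) ltn0.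
rewrite vb; pose u := [multinom row_sum z'' l | l < n].
have uE l : u l = row_sum z'' l by rewrite mnmE.
have uB : flow_vector tau u by exists z''; split=> // l; rewrite uE.
(* Before b the vectors v and w agree, so the decrease happens after b. *)
have ab : (b < a)%N.
  have neq : a != b by apply: contraTneq z'a => ->; rewrite zv zw -leqNgt ltnW.
  have : ~~ (a < b)%N.
    by apply: contraTN z'a => ab; rewrite zv zw -vw_eq // ltnn.
  rewrite -leqNgt leq_eqVlt eq_sym; case/orP => // /eqP/val_inj ab.
  by rewrite ab eqxx in neq.
have vu : (v < u)%O.
  apply/ltmcP; first by rewrite degv (flow_vector_mdeg uB).
  exists b => [l lb|].
    have := rz'' l; rewrite uE zv -!val_eqE /= (gtn_eqF lb) (gtn_eqF (ltn_trans lb ab)).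
    by rewrite !addn0.
  have := rz'' b; rewrite uE zv eqxx -val_eqE /= (gtn_eqF ab) addn0 => ->.
  by rewrite addn1.
apply/hasP; exists u.
  have : u \in L by apply/LB.
  rewrite LE mem_cat inE => /or3P[//|/eqP uv|/vL2 uv].
    by rewrite uv ltxx in vu.
  by have := le_lt_trans (uv : (u <= v)%O) vu; rewrite ltxx.
by apply/forall_inP => l _; rewrite uE -zv [l == b]eq_sym -rz'' leq_addr.
Qed.

Lemma fiber_flow_complex tau L A : (forall v, v \in L <-> flow_vector tau v) ->
  fiber_complex W tau m L A <-> flow_complex A /\ A :\: W = tau.
Proof.
move=> LB; split=> [/andP[/eqP tA /hasP[v /LB[z [fz cz zv]] /forall_inP vA]]|].
  split=> //; exists z => // l; case: (boolP (l \in W)) => lW.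
    by rewrite (col_sum_in E_bip fz lW) addn0 zv; apply: vA.
  rewrite (row_sum_out E_bip fz lW) add0n.
  by have := cz l lW; rewrite -tA inE lW.
move=> [[z fz zA] tA]; rewrite /fiber_complex tA eqxx; apply/hasP.
pose v := [multinom row_sum z l | l < n].
exists v.
  apply/LB; exists z; split=> // [y yW|l]; last by rewrite mnmE.
  by have := zA y; rewrite (row_sum_out E_bip fz yW) add0n -tA inE yW.
apply/forall_inP => l lW; have := zA l.
by rewrite (col_sum_in E_bip fz lW) addn0 mnmE.
Qed.

Lemma exact_at_flow_fiber (R : comNzRingType) (V : lmodType R) tau i :
  (i + q < \sum_(l in W) m l + #|tau|)%N ->
  exact_at V W (fun A => flow_complex A /\ A :\: W = tau) i.
Proof.
move=> iq; have [L [sL uL LB]] := flow_vector_enum tau.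
apply: (eq_exact_at (fun A => fiber_flow_complex A LB)).
apply: exact_at_linear_quotients iq; first exact: linear_quotients_flow LB.
move=> v /LB [z [fz _ zv]]; have [_ <-] := fz.
rewrite total_row_sum [RHS](bigID (mem W)) /= [X in _ = (_ + X)%N]big1 ?addn0.
  by apply: eq_bigr => l _; rewrite zv.
by move=> l; apply: row_sum_out fz.
Qed.

Lemma flow_complex_setU l A : flow_complex (l |: A) -> flow_complex A.
Proof.
move=> [z fz zA]; exists z => // x; apply: leq_trans (zA x).
by rewrite leq_add2l !inE; case: (x \in A); rewrite ?orbT.
Qed.

(** Enough degree on the [W] side: every fiber is in its exact range. *)
Lemma exact_at_flow_few (R : comNzRingType) (V : lmodType R) i :
  (i + q < \sum_(l in W) m l)%N -> exact_at V setT flow_complex i.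
Proof.
move=> iq; apply: (@exact_at_total _ _ _ W); first exact: flow_complex_setU.
by move=> tau; apply: exact_at_flow_fiber; apply: leq_trans iq (leq_addr _ _).
Qed.

(** The fibers outside the range of linear quotients are those where the size
    of [A :&: W] is at least the size of [W]. There a chain lives on the single
    set [W :|: tau], and it has a zero boundary only if it is zero. *)
Lemma exact_at_flow_many (R : comNzRingType) (V : lmodType R) i :
  (0 < #|W|)%N -> (q + #|W| <= \sum_(l in W) m l)%N ->
  exact_at V setT flow_complex i.
Proof.
move=> W0 qW; apply: (@exact_at_total _ _ _ W); first exact: flow_complex_setU.
move=> tau; case: (ltnP (i + q) (\sum_(l in W) m l + #|tau|)) => iq.
  exact: exact_at_flow_fiber.
move=> f sf cf; exists (fun=> 0) => [A|A]; first by rewrite eqxx.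
rewrite boundary0 //; apply/eqP; apply: contraTT isT => nz.
have [[_ tA] Ai] := sf A nz.
have WA : W \subset A.
  have AW : (#|W| <= #|A :&: W|)%N by have := cardsID W A; rewrite tA Ai; lia.
  rewrite -(_ : A :&: W = W) ?subsetIl //; apply/eqP.
  by rewrite eqEcard subsetIr.
have [l lW] : exists l, l \in W by apply/set0Pn; rewrite -card_gt0.
have lA := subsetP WA l lW.
have := cf (A :\ l); rewrite /boundary (bigD1 l) /=; last by rewrite lW !inE eqxx.
rewrite big1 ?addr0 => [|x /andP[/andP[xW]]].
  move=> /eqP; rewrite setD1K // mulr1 -signr_odd.
  by case: (odd _); rewrite ?expr1 ?expr0 ?scaleN1r ?scale1r ?oppr_eq0 (negbTE nz).
by rewrite !inE (subsetP WA x xW) andbT negbK => ->.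
Qed.

End Polymatroid.

Section Bipartite.
Variables (n : nat) (W : {set 'I_n}) (E : rel 'I_n).
Hypothesis E_bip : forall u v, E u v -> u \in W /\ v \notin W.

Lemma flow_complex_transpose q m A :
  flow_complex E q m A <-> flow_complex (fun u v => E v u) q m A.
Proof.
pose sw (x : 'I_n * 'I_n) := (x.2, x.1).
have swI : injective sw by case=> [? ?] [? ?] [-> ->].
have swapE (P : pred ('I_n * 'I_n)) z :
    (\sum_(x | P x) z x = \sum_(x | P (sw x)) z (sw x))%N.
  exact: reindex_inj.
have rowT z l : row_sum (z \o sw) l = col_sum z l.
  exact: esym (swapE (fun x => x.2 == l) z).
have colT z l : col_sum (z \o sw) l = row_sum z l.
  exact: esym (swapE (fun x => x.1 == l) z).
split=> -[z [zE zq] zA]; exists (z \o sw) => [|l];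
  rewrite ?rowT ?colT ?[(col_sum z l + _)%N]addnC //;
  by split=> [x /zE //|]; rewrite -zq [RHS](swapE xpredT).
Qed.

(** Either the degree of [m] on [~: W] is small, and then the degree on [W] is
    large, or it is large and the roles of the two sides are exchanged. *)
Theorem exact_at_flow (R : comNzRingType) (V : lmodType R) q m i :
  (0 < #|~: W|)%N -> (i + 2 * q + #|~: W| <= mdeg m)%N ->
  exact_at V setT (flow_complex E q m) i.
Proof.
move=> W0; have -> : mdeg m = (\sum_(l in W) m l + \sum_(l in ~: W) m l)%N.
  rewrite mdegE (bigID (mem W)) /=; congr (_ + _)%N.
  by apply: eq_bigl => l; rewrite inE.
have [qW _|qW iq] := leqP (q + #|~: W|) (\sum_(l in ~: W) m l); last first.
  by apply: (exact_at_flow_few E_bip); move: iq qW; lia.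
apply: (eq_exact_at (fun A => iff_sym (flow_complex_transpose q m A))).
apply: (@exact_at_flow_many _ (~: W)) => // u v /E_bip[uW vW].
by rewrite !inE uW vW.
Qed.

End Bipartite.

(** * Powers of edge ideals as monomial ideals *)

Section PowersOfEdgeIdeal.
Variables (K : fieldType) (n : nat) (W : {set 'I_n}) (e : rel 'I_n).
Hypothesis e_sym : forall u v, e u v -> e v u.
Hypothesis e_bip : forall u v, e u v -> (u \in W) = (v \notin W).
Local Notation S := {mpoly K[n]}.
Implicit Types (m : 'X_{1..n}) (a : S) (G : S -> Prop).

(** Each edge is directed from [W] to its complement, so that flows count it
    once. *)
Definition oriented : rel 'I_n := fun u v => e u v && (u \in W).

Lemma oriented_bip u v : oriented u v -> u \in W /\ v \notin W.
Proof. by move=> /andP[/e_bip <-]. Qed.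

(** The monomial [m] is divisible by a product of [q] edges, with the choice of
    the edges recorded by their multiplicities. *)
Definition mono_pow q m : Prop := flow_complex oriented q m set0.

Lemma mono_powP q m : mono_pow q m <-> exists2 z, flow oriented q z &
  forall l, (row_sum z l + col_sum z l <= m l)%N.
Proof.
by split=> -[z fz zm]; exists z => // l; move: (zm l); rewrite inE addn0.
Qed.

Lemma mono_powD q q' m m' :
  mono_pow q m -> mono_pow q' m' -> mono_pow (q + q') (m + m').
Proof.
move=> /mono_powP[z [zE <-] zm] /mono_powP[z' [zE' <-] zm'].
apply/mono_powP; exists (fun x => z x + z' x)%N.
  split; last by rewrite big_split.
  by move=> x; rewrite addn_gt0 => /orP[/zE|/zE'].
move=> l; rewrite mnmDE /row_sum /col_sum !big_split addnACA.
exact: leq_add (zm l) (zm' l).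
Qed.

Lemma mono_pow0 m : mono_pow 0 m.
Proof.
apply/mono_powP; exists (fun=> 0%N); first by split => //; rewrite big1.
by move=> l; rewrite /row_sum /col_sum !big1.
Qed.

Lemma mono_powDr q m m' : mono_pow q m -> mono_pow q (m + m').
Proof. by move=> mq; rewrite -[q]addn0; apply: mono_powD (mono_pow0 _). Qed.

Lemma mono_pow_edge u v : e u v -> mono_pow 1 (U_(u) + U_(v)).
Proof.
suff H x : oriented x.1 x.2 -> mono_pow 1 (U_(x.1) + U_(x.2)).
  move=> uv; case: (boolP (u \in W)) => uW.
    by apply: (H (u, v)); rewrite /oriented /= uv.
  rewrite addmC; apply: (H (v, u)); rewrite /oriented /= (e_sym uv).
  by have := e_bip uv; rewrite (negbTE uW) => /esym/negbFE.
have sumP (P : pred ('I_n * 'I_n)) := sum_indicator P x.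
move=> xE; apply/mono_powP; exists (fun y => nat_of_bool (y == x)).
  split=> [y|]; first by case: (y =P x) => // ->.
  by rewrite (sumP xpredT).
move=> l; rewrite mnmDE !mnm1E.
by rewrite /row_sum /col_sum (sumP (fun y => y.1 == l)) (sumP (fun y => y.2 == l)).
Qed.

Lemma mcoeffM_neq0 a b m : (a * b)@_m != 0 ->
  exists m1 m2, [/\ m = (m1 + m2)%MM, a@_m1 != 0 & b@_m2 != 0].
Proof.
rewrite -mcoeff_msupp => /msuppM_le/allpairsP[[m1 m2] /= [h1 h2 ->]].
by exists m1, m2; rewrite -!mcoeff_msupp.
Qed.

Lemma ideal_gen_mono q G : (forall a, G a -> forall m, a@_m != 0 -> mono_pow q m) ->
  forall a, ideal_gen G a -> forall m, a@_m != 0 -> mono_pow q m.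
Proof.
move=> GQ a [r [c [g [Gg ->]]]] m; rewrite raddf_sum => nz.
have [j] : exists i, (c i * g i)@_m != 0.
  apply: contraNP nz => no; rewrite big1 // => i _; apply/eqP.
  by apply: contra_notT no => ci; exists i.
move=> /mcoeffM_neq0[m1 [m2 [-> _ /(GQ _ (Gg j)) mq]]].
by rewrite addmC; apply: mono_powDr.
Qed.

Lemma ideal_pow_mono q a : ideal_pow (edge_ideal K e) q a ->
  forall m, a@_m != 0 -> mono_pow q m.
Proof.
apply: ideal_gen_mono => {}a [f [fe ->]].
elim: q f fe => [|q IH] f fe m; first by move=> _; apply: mono_pow0.
rewrite big_ord_recr /= => /mcoeffM_neq0[m1 [m2 [-> h1 h2]]].
rewrite -addn1; apply: mono_powD; first exact: IH h1.
apply: (ideal_gen_mono _ (fe ord_max) h2) => b [u [v [uv ->]]] m'.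
rewrite -mpolyXD mcoeffX; case: (_ =P m') => [<- _|_]; last by rewrite eqxx.
exact: mono_pow_edge.
Qed.

(** A flow of amount [q] is peeled off one edge at a time. *)
Lemma mono_pow_factor q m : mono_pow q m -> exists f : 'I_q -> S,
  (forall i, edge_ideal K e (f i)) /\ exists c : S, 'X_[m] = c * \prod_i f i.
Proof.
elim: q m => [|q IH] m.
  by move=> _; exists (fun=> 0); split=> [[]//|]; exists 'X_[m]; rewrite big_ord0 mulr1.
move=> /mono_powP[z [zE zq] zm].
have [x _ zx] : exists2 x, xpredT x & (0 < z x)%N.
  by apply: ltn_sum_exists; rewrite zq big1.
have /andP[xe xW] := zE x zx.
pose z' y := (z y - (y == x))%N.
have zz' y : z y = (z' y + (y == x))%N.
  by rewrite /z' subnK //; case: eqP => // ->.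
have sumP (P : pred ('I_n * 'I_n)) :
    (\sum_(y | P y) z y = \sum_(y | P y) z' y + P x)%N.
  by rewrite (eq_bigr _ (fun y _ => zz' y)) big_split /= sum_indicator.
have rz l : row_sum z l = (row_sum z' l + (x.1 == l))%N by apply: sumP.
have cz l : col_sum z l = (col_sum z' l + (x.2 == l))%N by apply: sumP.
pose m' := (m - (U_(x.1) + U_(x.2)))%MM.
have le_m : (U_(x.1) + U_(x.2) <= m)%MM.
  apply/mnm_lepP => l; rewrite mnmDE !mnm1E; apply: leq_trans (zm l).
  by rewrite rz cz; lia.
have [|f [fe [c cE]]] := IH m'.
  apply/mono_powP; exists z' => [|l].
    split=> [y z'y|]; first by apply: zE; rewrite zz' addn_gt0 z'y.
    by apply/eqP; rewrite -(eqn_add2r 1) -(sumP xpredT) zq addn1.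
  have := zm l; rewrite rz cz mnmBE mnmDE !mnm1E; lia.
exists (fun i => if unlift ord0 i is Some j then f j else 'X_(x.1) * 'X_(x.2)).
split=> [i|].
  case: unliftP => [j _|_]; first exact: fe.
  exists 1, (fun=> 1), (fun=> 'X_(x.1) * 'X_(x.2)).
  split; last by rewrite big_ord1 mul1r.
  by move=> _; exists x.1, x.2.
exists c; rewrite big_ord_recl unlift_none; under eq_bigr do rewrite liftK.
by rewrite mulrCA -cE -!mpolyXD addmC submK.
Qed.

Lemma ideal_powE q a : ideal_pow (edge_ideal K e) q a <->
  forall m, a@_m != 0 -> mono_pow q m.
Proof.
split; first exact: ideal_pow_mono.
move=> aq.
pose m_ (i : 'I_(size (msupp a))) := nth 0%MM (msupp a) i.
have mP i : m_ i \in msupp a by apply: mem_nth.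
have /choice[F HF] i : exists fc : ('I_q -> S) * S,
    (forall j, edge_ideal K e (fc.1 j)) /\ 'X_[m_ i] = fc.2 * \prod_j fc.1 j.
  have [|f [fe [c cE]]] := @mono_pow_factor q (m_ i); last by exists (f, c).
  by apply: aq; rewrite -mcoeff_msupp.
exists (size (msupp a)), (fun i => a@_(m_ i) *: (F i).2), (fun i => \prod_j (F i).1 j).
split=> [i|]; first by exists (F i).1; split=> //; case: (HF i).
rewrite {1}[a]mpolyE (big_nth 0%MM) big_mkord; apply: eq_bigr => i _.
by have [_ E] := HF i; rewrite -scalerAl -E.
Qed.

Lemma flow_complex_shift q m A : flow_complex oriented q m A <->
  (mesym1 A <= m)%MM /\ mono_pow q (m - mesym1 A).
Proof.
have AE l : mesym1 A l = (l \in A) by rewrite mnmE.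
split=> [[z fz zm]|[/mnm_lepP Am /mono_powP[z fz zm]]].
  have Am l : (mesym1 A l <= m l)%N.
    by rewrite AE; apply: leq_trans (zm l); rewrite leq_addl.
  split; first exact/mnm_lepP.
  by apply/mono_powP; exists z => // l; rewrite mnmBE leq_subRL // AE addnC.
by exists z => // l; rewrite -AE addnC -leq_subRL // -mnmBE.
Qed.

End PowersOfEdgeIdeal.

(** * Koszul complexes of graded submodules of free modules *)

Section KoszulComplex.
Variables (K : fieldType) (n : nat).
Local Notation S := {mpoly K[n]}.
Implicit Types (m u : 'X_{1..n}) (A B : {set 'I_n}) (p : S).

Lemma mcoeff_signM k p m : ((-1) ^+ k * p)@_m = (-1) ^+ k * p@_m.
Proof.
by rewrite -!(signr_odd _ k); case: odd; rewrite ?mul1r ?expr1 ?mulN1r ?mcoeffN.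
Qed.

Lemma mcoeffXM (l : 'I_n) p m :
  ('X_l * p)@_m = if (U_(l) <= m)%MM then p@_(m - U_(l)) else 0.
Proof.
case: ifP => lm; first by rewrite -{1}(submK lm) addmC mulrC mcoeffMX.
apply: contraFeq lm => /mcoeffM_neq0[m1 [m2 [-> + _]]].
by rewrite mcoeffX; case: (_ =P m1) => [<- _|]; rewrite ?eqxx // lem_addr.
Qed.

Section FreeModule.
Variable r : nat.
Variable a : 'I_r -> nat.
Local Notation V := 'rV[S]_r.
Implicit Types (w x : {set 'I_n} -> V) (M : V -> Prop) (v : V).

Definition koszul_d w A : V := boundary (fun l => 'X_l : S) setT w A.

(** The chains of homological degree [i] and internal degree [j] of the Koszul
    complex with coefficients in the submodule [M] of [\bigoplus_c S(- a c)]. *)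
Definition koszul_chain M i j w : Prop :=
  (forall A, M (w A)) /\
  forall A c m, (w A 0 c)@_m != 0 -> #|A| = i /\ (mdeg m + a c + #|A| = j)%N.

Definition koszul_exact M i j : Prop := forall w,
  koszul_chain M i j w -> (forall A, koszul_d w A = 0) ->
  exists2 x, koszul_chain M i.+1 j x & forall A, w A = koszul_d x A.

(** The part of multidegree [u] of the component [c]. Multiplication by a
    variable becomes the identity on these coefficients, so the Koszul
    differential becomes the simplicial boundary ([strand_koszul_d]). *)
Definition strand w (c : 'I_r) u A : K^o :=
  if (mesym1 A <= u)%MM then (w A 0 c)@_(u - mesym1 A) else 0.

Local Notation bd := (@boundary n K K^o (fun=> 1)).

Lemma mesym1_setU (l : 'I_n) A : l \notin A ->
  mesym1 (l |: A) = (mesym1 A + U_(l))%MM.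
Proof.
move=> lA; apply/mnmP => x; rewrite mnmDE mnm1E !mnmE !inE eq_sym.
by case: eqP => [<-|_] /=; rewrite ?(negbTE lA) // addn0.
Qed.

Lemma strand_koszul_d w c u A :
  strand (koszul_d w) c u A = bd setT (strand w c u) A.
Proof.
rewrite {1}/strand; case: ifP => [Au|/negbT Au]; last first.
  rewrite /boundary big1 // => l /andP[_ lA]; rewrite /strand ifN ?scaler0 //.
  by apply: contra Au; rewrite mesym1_setU //; apply: lepm_trans (lem_addr _ _).
rewrite /koszul_d /boundary summxE raddf_sum; apply: eq_bigr => l /andP[_ lA] /=.
rewrite mxE mulr1 -mulrA mcoeff_signM; congr (_ * _).
rewrite mcoeffXM /strand mesym1_setU // submDA.
congr (if _ then _ else _); apply/mnm_lepP/mnm_lepP => le x; have := le x;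
  have := mnm_lepP Au x; rewrite ?mnmDE ?mnmBE; lia.
Qed.

(** A chain is a boundary when each of its strands is one; the predicate [Q]
    carries along membership in a monomial submodule. *)
Lemma koszul_lift (Q : 'I_r -> 'X_{1..n} -> Prop) i j w :
  koszul_chain (fun=> True) i j w ->
  (forall c u, (mdeg u + a c)%N = j ->
     exists2 g, supported (fun A => (mesym1 A <= u)%MM /\ Q c (u - mesym1 A)%MM) i.+1 g
       & forall A, strand w c u A = bd setT g A) ->
  exists2 x, koszul_chain (fun v => forall c m, (v 0 c)@_m != 0 -> Q c m) i.+1 j x
    & forall A, w A = koszul_d x A.
Proof.
move=> [_ wh] H.
have /choice[G HG] cu : exists g, (mdeg cu.2 + a cu.1)%N = j ->
    supported (fun A => (mesym1 A <= cu.2)%MM /\ Q cu.1 (cu.2 - mesym1 A)%MM) i.+1 g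
       /\ forall A, strand w cu.1 cu.2 A = bd setT g A.
  case: cu => c u /=; case: (eqVneq (mdeg u + a c)%N j) => [uj|/eqP uj].
    by have [g sg gE] := H c u uj; exists g.
  by exists (fun=> 0).
(* The strands of degree j are glued into polynomials. *)
pose x A : V := \row_c \sum_(u : 'X_{1..n < j.+1} | (mdeg u + a c == j)%N)
  G (c, bmnm u) A *: 'X_[u - mesym1 A].
have xE A c m : (x A 0 c)@_m =
    if (mdeg (m + mesym1 A) + a c == j)%N then G (c, m + mesym1 A)%MM A else 0.
  rewrite mxE raddf_sum /=.
  have term (u : 'X_{1..n < j.+1}) : (mdeg u + a c == j)%N ->
      (G (c, bmnm u) A *: 'X_[u - mesym1 A])@_m =
      if (u == m + mesym1 A :> 'X_{1..n})%MM then G (c, bmnm u) A else 0.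
    move=> /eqP uj; rewrite mcoeffZ mcoeffX.
    have [/eqP ->|nz] := boolP (G (c, bmnm u) A == 0); first by rewrite mul0r if_same.
    have [sG _] := HG (c, bmnm u) uj; have [[/= Au _] _] := sG _ nz.
    have -> : (u - mesym1 A == m)%MM = (bmnm u == (m + mesym1 A)%MM).
      by apply/eqP/eqP => [<-|->]; rewrite ?submK ?addmK.
    by case: ifP; rewrite ?mulr1 ?mulr0.
  rewrite (eq_bigr _ term) -big_mkcondr /=.
  case: ifP => [mj|mj].
    have bj : (mdeg (m + mesym1 A) < j.+1)%N by rewrite ltnS -(eqP mj) leq_addr.
    rewrite (big_pred1 (BMultinom bj)) // => u /=.
    apply/andP/eqP => [[_ /eqP uE]|-> /=]; last by rewrite mj eqxx.
    by apply/eqP; rewrite bmeqP uE.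
  rewrite big_pred0 // => u; apply/andP => -[uj /eqP uE].
  by rewrite uE mj in uj.
exists x.
  split=> [A c m|A c m]; rewrite xE; case: (_ =P j) => [uj|]; rewrite ?eqxx // => nz.
    have [sG _] := HG (c, (m + mesym1 A)%MM) uj; have [[_ /=]] := sG _ nz.
    by rewrite addmK.
  have [sG _] := HG (c, (m + mesym1 A)%MM) uj; have [_ Ai] := sG _ nz.
  by split=> //; rewrite -uj mdegD mdeg_mesym1 addnAC.
have strandx c u A : strand x c u A = if (mdeg u + a c == j)%N then G (c, u) A else 0.
  rewrite /strand; case: ifP => [Au|Au]; first by rewrite xE submK.
  case: (_ =P j) => // uj; have [sG _] := HG (c, u) uj.
  by apply/eqP; rewrite eq_sym; apply: contraFT Au => /sG[[]].
move=> A; apply/rowP => c; apply/mpolyP => m.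
have sE v : (v 0 c)@_m = strand (fun=> v) c (m + mesym1 A) A.
  by rewrite /strand lem_addl addmK.
rewrite !sE -[LHS]/(strand w c (m + mesym1 A) A).
rewrite -[RHS]/(strand (koszul_d x) c (m + mesym1 A) A) strand_koszul_d.
rewrite (eq_boundary _ _ (strandx c (m + mesym1 A)%MM)).
case: (_ =P j) => [uj|uj]; first by have [_ ->] := HG (c, (m + mesym1 A)%MM) uj.
rewrite boundary0 // /strand; case: ifP => // _; apply/eqP; apply/negP => /negP nz.
have [_ mj] := wh _ _ _ nz; case: uj; rewrite -mj addnAC mdegD mdeg_mesym1.
by rewrite addmK.
Qed.

(** The strand at [u] of a free module is the full simplex on the variables that
    divide [u], a cone unless [u] is trivial. The assumption on constant
    coefficients disposes of that last strand, where [H_0] lives. *)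
Lemma koszul_exact_free i j w :
  koszul_chain (fun=> True) i j w -> (forall A, koszul_d w A = 0) ->
  (forall c, (w set0 0 c)@_0%MM = 0) ->
  exists2 x, koszul_chain (fun=> True) i.+1 j x & forall A, w A = koszul_d x A.
Proof.
move=> wc dw w0.
have [|x [_ xh] wx] := @koszul_lift (fun _ _ => True) i j w wc; last by exists x.
move=> c u uj.
have cs A : bd setT (strand w c u) A = 0.
  by rewrite -strand_koszul_d /strand dw mxE mcoeff0 if_same.
have sw A : strand w c u A != 0 -> (mesym1 A <= u)%MM /\ #|A| = i.
  by rewrite /strand; case: ifP => // Au; rewrite ?eqxx // => /(wc.2 _ _ _)[].
case: (eqVneq u 0%MM) => [u0|].
  exists (fun=> 0) => [A|A]; rewrite ?eqxx // boundary0 //; apply/eqP.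
  apply/negP => /negP nz; have [/mnm_lepP Au _] := sw A nz.
  have A0 : A = set0.
    by apply/setP => l; have := Au l; rewrite u0 mnm0E mnmE inE; case: (l \in A).
  move: nz; rewrite A0 /strand u0 sub0m w0; case: ifP; rewrite eqxx //.
rewrite -mdeg_eq0 mdegE sum_nat_eq0 => /forallPn[t /= ut].
exists (cone t (strand w c u)) => [A|A].
  rewrite /cone; case: ifP => [tA nz|_]; last by rewrite eqxx.
  have [|/mnm_lepP Au Ai] := sw (A :\ t).
    by apply: contraNneq nz => ->; rewrite scaler0.
  split; last by rewrite (cardsD1 t) tA Ai.
  split=> //; apply/mnm_lepP => l; have := Au l; rewrite !mnmE !inE.
  by case: eqP => [-> _|//]; rewrite tA lt0n.
rewrite -[LHS](boundary_cone (strand w c u) A (in_setT t)) [cone _ _ A]/cone.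
by case: ifP => _; rewrite ?cs ?scaler0 addr0.
Qed.

End FreeModule.

(** The degrees are added, not subtracted, so that nothing is truncated when
    an entry vanishes. *)
Definition graded_mx r' r (a' : 'I_r' -> nat) (a : 'I_r -> nat)
    (D : 'M[S]_(r', r)) : Prop :=
  forall i c m, (D i c)@_m != 0 -> (mdeg m + a c)%N = a' i.

(** The offset [s] stands for the size of the index [A] of a Koszul chain, which
    contributes to the degree. *)
Definition homog_part r (a : 'I_r -> nat) (s e : nat) (v : 'rV[S]_r) : 'rV[S]_r :=
  \row_c \sum_(m <- msupp (v 0 c) | (mdeg m + a c + s == e)%N)
    (v 0 c)@_m *: 'X_[m].

Lemma homog_partE r (a : 'I_r -> nat) s e (v : 'rV[S]_r) c m :
  (homog_part a s e v 0 c)@_m =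
  if (mdeg m + a c + s == e)%N then (v 0 c)@_m else 0.
Proof.
rewrite mxE raddf_sum /=; under eq_bigr do rewrite mcoeffZ mcoeffX.
case: (boolP (m \in msupp (v 0 c))) => mv; last first.
  rewrite (memN_msupp_eq0 mv) if_same big_seq_cond big1 // => u /andP[uv _].
  by case: (u =P m) => [um|]; [rewrite um (negbTE mv) in uv | rewrite mulr0].
rewrite big_mkcond (bigD1_seq m) ?msupp_uniq //= eqxx mulr1 big1 ?addr0 // => u um.
by rewrite (negbTE um) mulr0 if_same.
Qed.

Lemma homog_part_mul r' r (a' : 'I_r' -> nat) (a : 'I_r -> nat) D s e v :
  graded_mx a' a D -> homog_part a' s e v *m D = homog_part a s e (v *m D).
Proof.
move=> gD; apply/rowP => c; apply/mpolyP => m; rewrite homog_partE !mxE !raddf_sum.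
rewrite -[RHS]/(if _ then _ else _) (_ : (if _ then _ else _) =
  \sum_i (if (mdeg m + a c + s == e)%N then (v 0 i * D i c)@_m else 0)); last first.
  by case: ifP => // _; rewrite big1.
apply: eq_bigr => i _; rewrite /= !mcoeffM.
rewrite (_ : (if _ then _ else _) =
  \sum_(k : 'X_{1..n < (mdeg m).+1, (mdeg m).+1} | m == (k.1 + k.2)%MM)
     (if (mdeg m + a c + s == e)%N then (v 0 i)@_k.1 * (D i c)@_k.2 else 0)); last first.
  by case: ifP => // _; rewrite big1.
apply: eq_bigr => k /eqP mk; rewrite homog_partE.
case: (eqVneq (D i c)@_k.2 0) => [->|/gD <-]; first by rewrite !mulr0 if_same.
have -> : (mdeg k.1 + (mdeg k.2 + a c) + s = mdeg m + a c + s)%N.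
  by have := congr1 mdeg mk; rewrite mdegD => mkd; rewrite addnA -mkd.
by case: ifP => // _; rewrite mul0r.
Qed.

Lemma homog_part_id r (a : 'I_r -> nat) s e (v : 'rV[S]_r) :
  (forall c m, (v 0 c)@_m != 0 -> (mdeg m + a c + s)%N = e) ->
  homog_part a s e v = v.
Proof.
move=> vh; apply/rowP => c; apply/mpolyP => m; rewrite homog_partE.
by case: eqP => // ne; apply/eqP; rewrite eq_sym; apply/negP => /negP /vh.
Qed.

Lemma koszul_d_mul r' r (D : 'M[S]_(r', r)) (w : {set 'I_n} -> 'rV[S]_r') A :
  koszul_d (fun B => w B *m D) A = koszul_d w A *m D.
Proof.
by rewrite /koszul_d /boundary mulmx_suml; apply: eq_bigr => l _; rewrite scalemxAl.
Qed.

Lemma koszul_chain_mul r' r (a' : 'I_r' -> nat) (a : 'I_r -> nat)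
    (D : 'M[S]_(r', r)) i j w (M : 'rV[S]_r -> Prop) :
  graded_mx a' a D -> koszul_chain a' (fun=> True) i j w ->
  (forall v, M (v *m D)) -> koszul_chain a M i j (fun A => w A *m D).
Proof.
move=> gD [_ wh] MD; split=> // A c m; rewrite mxE raddf_sum => nz.
have [k] : exists k, (w A 0 k * D k c)@_m != 0.
  apply: contraNP nz => no; rewrite big1 // => k _; apply/eqP.
  by apply: contra_notT no => kn; exists k.
move=> /mcoeffM_neq0[m1 [m2 [-> /wh[Ai Aj] /gD gk]]]; split=> //.
by rewrite -Aj -gk mdegD; lia.
Qed.

(** The connecting map of the long exact sequence of [0 -> N -> F -> M -> 0],
    where [D] is the map [F -> M]. A cycle of [N] is a boundary in [F]; for
    [i = 0] this uses that minimality puts [N] inside the maximal ideal times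
    [F]. The image in [M] of the bounding chain is a cycle, hence a boundary,
    and correcting by a lift of what it bounds brings the chain into [N]. *)
Lemma koszul_exact_syzygy r' r (a' : 'I_r' -> nat) (a : 'I_r -> nat)
    (D : 'M[S]_(r', r)) (M : 'rV[S]_r -> Prop) i j :
  graded_mx a' a D -> (forall x, M x <-> exists v, x = v *m D) ->
  (forall v : 'rV_r', v *m D = 0 -> forall c, (v 0 c)@_0%MM = 0) ->
  koszul_exact a M i.+1 j -> koszul_exact a' (fun v : 'rV_r' => v *m D = 0) i j.
Proof.
move=> gD MD minD ex w [wD wh] dw.
have MvD v : M (v *m D) by apply/MD; exists v.
have [||x xc wx] := @koszul_exact_free _ a' i j w _ dw.
- by split.
- exact: minD (wD set0).
have [|A|y [yM yh] xy] := ex (fun A => x A *m D).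
- exact: koszul_chain_mul xc MvD.
- by rewrite koszul_d_mul -wx wD.
have /choice[Y HY] A : exists v, y A = v *m D by apply/MD.
(* A homogeneous lift of the chain y along D. *)
pose z A := if #|A| == i.+2 then homog_part a' #|A| j (Y A) else 0.
have zD A : z A *m D = y A.
  rewrite /z; case: eqP => Ai.
    rewrite (homog_part_mul _ _ _ gD) -HY homog_part_id // => c m /yh[_] //.
  rewrite mul0mx; apply/esym/rowP => c; apply/mpolyP => m; rewrite mxE mcoeff0.
  by apply/eqP; apply/negP => /negP /yh[].
have zh A c m : (z A 0 c)@_m != 0 -> #|A| = i.+2 /\ (mdeg m + a' c + #|A| = j)%N.
  rewrite /z; case: (#|A| =P i.+2) => [Ai|_]; last by rewrite mxE mcoeff0 eqxx.
  by rewrite homog_partE; case: (_ =P j) => [//|_]; rewrite eqxx.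
exists (fun A => x A - koszul_d z A); last first.
  by move=> A; rewrite /koszul_d boundaryB boundaryK subr0; apply: wx.
split=> [A|A c m].
  by rewrite mulmxBl -koszul_d_mul xy /koszul_d (eq_boundary _ _ zD) subrr.
rewrite !mxE mcoeffB; case: (eqVneq (x A 0 c)@_m 0) => [->|/(xc.2 _ _ _) //].
rewrite sub0r oppr_eq0 /koszul_d /boundary summxE raddf_sum => nz.
have [l lA] : exists2 l : 'I_n, l \notin A & ('X_l * z (l |: A) 0 c)@_m != 0.
  apply: contraNP nz => no; rewrite big1 // => l /andP[_ lA]; rewrite mxE -mulrA.
  rewrite /= mcoeff_signM; apply/eqP; rewrite mulf_eq0; apply/orP; right.
  by apply: contra_notT no => ?; exists l.
move=> /mcoeffM_neq0[m1 [m2 [-> + /zh]]].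
rewrite mcoeffX; case: (_ =P m1) => [<- _|]; rewrite ?eqxx // cardsU1 lA add1n.
by move=> [[Ai] <-]; rewrite mdegD mdeg1 Ai; split=> //; lia.
Qed.

End KoszulComplex.

(** * Minimal homogeneous generators *)

(** Take a matrix of the largest rank: a vector outside its row space would be
    one more row, and the rank would go up. *)
Lemma max_rank_span (K : fieldType) N (P : 'rV[K]_N -> Prop) :
  exists t (A : 'M[K]_(t, N)), (forall i, P (row i A)) /\
    forall v, P v -> (v <= A)%MS.
Proof.
pose Q k := `[< exists t (A : 'M[K]_(t, N)), (forall i, P (row i A)) /\ \rank A = k >].
have Q0 : exists k, Q k.
  by exists 0%N; apply/asboolP; exists 0%N, 0; rewrite mxrank0; split=> // -[].
have QN k : Q k -> (k <= N)%N by move=> /asboolP[t [A [_ <-]]]; apply: rank_leq_col.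
case: (ex_maxnP Q0 QN) => k /asboolP[t [A [PA rA]]] kmax.
exists t, A; split=> // v Pv.
have QB : Q (\rank (col_mx A v)).
  apply/asboolP; exists (t + 1)%N, (col_mx A v); split=> // i.
  case: (split_ordP i) => l ->; rewrite ?rowKu ?rowKd //.
  by rewrite (_ : row l v = v) //; apply/rowP => c; rewrite mxE !ord1.
have AB : (A <= col_mx A v)%MS by rewrite -addsmxE addsmxSl.
have := (mxrank_leqif_sup AB).2; rewrite eqn_leq (mxrankS AB) {1}rA kmax //= => /esym.
by rewrite -addsmxE addsmx_sub => /andP[].
Qed.

Section Generators.
Variables (K : fieldType) (n : nat).
Local Notation S := {mpoly K[n]}.

Section GradedSubmodule.
Variables (r : nat) (a : 'I_r -> nat) (M : 'rV[S]_r -> Prop).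
Implicit Types (v x : 'rV[S]_r).

Definition homogeneous e v : Prop :=
  forall c m, (v 0 c)@_m != 0 -> (mdeg m + a c)%N = e.

Record graded_submodule : Prop := GradedSubmodule {
  submod0 : M 0;
  submodD : forall v x, M v -> M x -> M (v + x);
  submodZ : forall p v, M v -> M (p *: v);
  submod_homog : forall e v, M v -> M (homog_part a 0 e v)
}.

(** Vanishing of [H_0(M)_j] means that [M] has no generators in degree [j]. *)
Lemma koszul_exact0 j v :
  M 0 -> koszul_exact a M 0 j -> M v -> homogeneous j v ->
  exists y : 'I_n -> 'rV[S]_r, v = \sum_l 'X_l *: y l /\
    forall l, M (y l) /\ forall c m, (y l 0 c)@_m != 0 -> (mdeg m + a c).+1 = j.
Proof.
move=> M0 ex Mv vj.
have [||x [xM xh] vx] := ex (fun A => if A == set0 then v else 0).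
- split=> [A|A c m]; first by case: ifP.
  case: (A =P set0) => [->|_]; last by rewrite mxE mcoeff0 eqxx.
  by move=> /vj <-; rewrite cards0 addn0.
- move=> A; rewrite /koszul_d boundary0 // => l.
  by case: eqP => // /setP/(_ l); rewrite !inE eqxx.
exists (fun l => x (l |: set0)); split.
  have := vx set0; rewrite eqxx => ->; rewrite /koszul_d /boundary.
  apply: eq_big => [l|l _]; first by rewrite !inE.
  rewrite (_ : ksign l set0 = 0%N) ?expr0 ?mul1r //.
  by apply/eqP; rewrite cards_eq0; apply/eqP/setP => t; rewrite !inE.
by move=> l; split=> // c m /xh[Ai <-]; rewrite Ai addn1.
Qed.

(** A homogeneous element is determined by its finitely many coefficients, so
    the graded pieces are spaces of row vectors over [K]. *)
Lemma homogeneous_span e : exists t (g : 'I_t -> 'rV[S]_r),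
  (forall i, M (g i) /\ homogeneous e (g i)) /\
  forall v, M v -> homogeneous e v -> exists c : 'I_t -> K,
    v = \sum_i (c i)%:MP *: g i.
Proof.
pose T : finType := ('I_r * 'X_{1..n < e.+1})%type.
pose enc v : 'rV[K]_#|T| :=
  \row_i (v 0 (enum_val i).1)@_(bmnm (enum_val i).2).
have [t [A [PA spanA]]] := max_rank_span
  (fun y => exists2 v, M v /\ homogeneous e v & y = enc v).
have /choice[g gP] i : exists v, (M v /\ homogeneous e v) /\ row i A = enc v.
  by have [v Mv ->] := PA i; exists v.
exists t, g; split=> [i|v Mv ve]; first by case: (gP i).
have /submxP[w wE] : (enc v <= A)%MS by apply: spanA; exists v.
exists (fun i => w 0 i); apply/rowP => c; apply/mpolyP => m.
have sumE : ((\sum_i (w 0 i)%:MP *: g i) 0 c)@_m = \sum_i w 0 i * (g i 0 c)@_m.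
  rewrite summxE raddf_sum; apply: eq_bigr => i _.
  by rewrite mxE /= mcoeffCM.
rewrite sumE; have [me|ne] := eqVneq (mdeg m + a c)%N e; last first.
  rewrite big1 => [|i _]; first by apply/eqP; apply: contraNT ne => /ve ->.
  have [[_ gi] _] := gP i; apply/eqP; rewrite mulf_eq0; apply/orP; right.
  by apply: contraNT ne => /gi ->.
have lt_m : (mdeg m < e.+1)%N by rewrite ltnS -me leq_addr.
pose k : T := (c, BMultinom lt_m).
have encE x : enc x 0 (enum_rank k) = (x 0 c)@_m by rewrite mxE enum_rankK.
rewrite -encE wE mxE; apply: eq_bigr => i _; congr (_ * _).
by have [_ gi] := gP i; rewrite -encE -gi mxE.
Qed.

Lemma homogeneous_decomposition v : exists b,
  v = \sum_(e < b) homog_part a 0 e v.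
Proof.
exists (\max_(c < r) (msize (v ord0 c) + a c)).+1; apply/rowP => c; apply/mpolyP => m.
rewrite summxE raddf_sum /=.
under eq_bigr do rewrite homog_partE addn0.
have [v0|vm] := eqVneq (v 0 c)@_m 0.
  by rewrite v0 big1 // => e _; rewrite if_same.
have lt_b : (mdeg m + a c < (\max_(c < r) (msize (v ord0 c) + a c)).+1)%N.
  rewrite ltnS; apply: leq_trans (leq_bigmax c); rewrite leq_add2r ltnW //.
  by apply: msize_mdeg_lt; rewrite mcoeff_msupp.
rewrite (bigD1 (Ordinal lt_b)) //= eqxx big1 ?addr0 // => e eb.
by rewrite ifN //; apply: contraNneq eb => eE; apply/eqP/val_inj.
Qed.

Definition generated_by r' (D : 'M[S]_(r', r)) : Prop :=
  forall x, M x <-> exists v : 'rV_r', x = v *m D.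

(** Finitely many elements span the pieces of degree less than [B], and the
    later pieces come from these by multiplication with variables: the
    vanishing of [H_0] replaces Hilbert's basis theorem. *)
Lemma finite_generation B : graded_submodule ->
  (forall j, (B <= j)%N -> koszul_exact a M 0 j) ->
  exists r' (a' : 'I_r' -> nat) (D : 'M[S]_(r', r)),
    graded_mx a' a D /\ generated_by D.
Proof.
move=> [M0 MD MZ Mh] ex.
have /choice[tg Hg] e : exists tg : {t & 'I_t -> 'rV[S]_r},
  (forall i, M (projT2 tg i) /\ homogeneous e (projT2 tg i)) /\
  forall v, M v -> homogeneous e v -> exists c : 'I_(projT1 tg) -> K,
    v = \sum_i (c i)%:MP *: projT2 tg i.
  by have [t [g Hg]] := homogeneous_span e; exists (existT _ t g).
pose t e := projT1 (tg e); pose g e : 'I_(t e) -> 'rV[S]_r := projT2 (tg e).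
(* The generators: spanning families of all pieces of degree less than B. *)
pose T : finType := {e : 'I_B & 'I_(t e)}.
pose gT (x : T) := g (tag x) (tagged x).
pose D : 'M[S]_(#|T|, r) := \matrix_i gT (enum_val i).
have rowD i : row i D = gT (enum_val i) by rewrite rowK.
exists #|T|, (fun i : 'I_#|T| => tag (enum_val i : T) : nat), D; split.
  move=> i c m; rewrite mxE.
  by have [_ h] := (Hg (tag (enum_val i : T))).1 (tagged (enum_val i : T)); apply: h.
pose img x := exists v : 'rV_#|T|, x = v *m D.
have img0 : img 0 by exists 0; rewrite mul0mx.
have imgD x y : img x -> img y -> img (x + y).
  by move=> [v ->] [w ->]; exists (v + w); rewrite mulmxDl.
have imgZ p x : img x -> img (p *: x).
  by move=> [v ->]; exists (p *: v); rewrite scalemxAl.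
have imgS (I : finType) (f : I -> 'rV[S]_r) : (forall i, img (f i)) -> img (\sum_i f i).
  by move=> fI; elim/big_rec: _ => // i x _; apply: imgD.
have imgg (e : 'I_B) i : img (g e i).
  exists (delta_mx 0 (enum_rank (Tagged (fun e : 'I_B => 'I_(t e)) i))).
  by rewrite -rowE rowD enum_rankK.
have imgh e : forall x, M x -> homogeneous e x -> img x.
  elim/ltn_ind: e => e IH x Mx xe; have [eB|Be] := ltnP e B.
    have [c ->] := (Hg (Ordinal eB)).2 x Mx xe.
    by apply: imgS => i; apply: imgZ; apply: (imgg (Ordinal eB)).
  have [y [-> yP]] := koszul_exact0 M0 (ex e Be) Mx xe.
  apply: imgS => l; apply: imgZ; have [My yh] := yP l.
  case: e IH yh {xe Be yP} => [|e] IH yh; last first.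
    by apply: (IH e) => // c m /yh[].
  suff -> : y l = 0 by [].
  apply/rowP => c; apply/mpolyP => m; rewrite mxE mcoeff0.
  by apply/eqP; apply/negP => /negP /yh.
move=> x; split=> [Mx|[v ->]].
  have [b ->] := homogeneous_decomposition x.
  apply: imgS => e; apply: (imgh e); first exact: Mh.
  by move=> c m; rewrite homog_partE addn0; case: (_ =P (e : nat)) => //; rewrite eqxx.
rewrite mulmx_sum_row; elim/big_rec: _ => // i y _; apply: MD; apply: MZ.
by rewrite rowD; have [] := (Hg (tag (enum_val i : T))).1 (tagged (enum_val i : T)).
Qed.

(** The kernel of [D] lies in the maximal ideal times the free module, that is,
    [D] is a minimal presentation. *)
Definition minimal_relations r' (D : 'M[S]_(r', r)) : Prop :=
  forall v : 'rV_r', v *m D = 0 -> forall c, (v 0 c)@_0%MM = 0.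

(** A relation with an invertible coefficient expresses a generator through the
    others. *)
Lemma drop_generator r' (a' : 'I_r'.+1 -> nat) (D : 'M[S]_(r'.+1, r))
    (v : 'rV_r'.+1) i :
  graded_mx a' a D -> generated_by D -> v *m D = 0 -> (v 0 i)@_0%MM != 0 ->
  graded_mx (a' \o lift i) a (row' i D) /\ generated_by (row' i D).
Proof.
move=> gD MD vD vi; split=> [k c m|x]; first by rewrite mxE; apply: gD.
rewrite MD; split=> -[w ->]; last first.
  exists (w *m rowsub (lift i) 1%:M).
  by rewrite -mulmxA mul_rowsub_mx mul1mx row'Esub.
(* In the degree of the i-th generator, the coefficient of that generator
   in the relation v is its constant term, a unit. *)
pose u := homog_part a' 0 (a' i) v.
have uD : u *m D = 0.
  rewrite (homog_part_mul _ _ _ gD) vD; apply/rowP => c; apply/mpolyP => m.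
  by rewrite homog_partE !mxE mcoeff0 if_same.
have ui : u 0 i = ((v 0 i)@_0%MM)%:MP.
  apply/mpolyP => m; rewrite homog_partE mcoeffC addn0 -[X in _ == X]add0n eqn_add2r.
  by rewrite mdeg_eq0; case: (m =P _) => [->|_]; rewrite ?mulr1 ?mulr0.
pose w' := w - (w 0 i * ((v 0 i)@_0%MM)^-1%:MP) *: u.
have w'i : w' 0 i = 0.
  have -> : w' 0 i = w 0 i - w 0 i * ((v 0 i)@_0%MM)^-1%:MP * u 0 i.
    by rewrite !mxE.
  by rewrite ui -mulrA -mpolyCM mulVf // mulr1 subrr.
have w'D : w' *m D = w *m D by rewrite mulmxBl -scalemxAl uD scaler0 subr0.
exists (col' i w'); rewrite -w'D; apply/rowP => c; rewrite !mxE (bigD1_ord i) //=.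
by rewrite w'i mul0r add0r; apply: eq_bigr => k _; rewrite !mxE.
Qed.

(** Take a homogeneous generating family with the least number of elements. *)
Lemma minimal_generation B : graded_submodule ->
  (forall j, (B <= j)%N -> koszul_exact a M 0 j) ->
  exists r' (a' : 'I_r' -> nat) (D : 'M[S]_(r', r)),
    [/\ graded_mx a' a D, generated_by D & minimal_relations D].
Proof.
move=> gM ex; pose Q k := `[< exists (a' : 'I_k -> nat) (D : 'M[S]_(k, r)),
    graded_mx a' a D /\ generated_by D >].
have exQ : exists k, Q k.
  have [k [a' [D gens]]] := finite_generation gM ex.
  by exists k; apply/asboolP; exists a', D.
case: (ex_minnP exQ) => k /asboolP[a' [D [gD MD]]] kmin.
exists k, a', D; split=> // v vD c; apply/eqP; apply: contraT => vc.
case: k a' D gD MD v vD c vc kmin => [|k] a' D gD MD v vD c vc kmin.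
  by case: c vc.
have [gD' MD'] := drop_generator gD MD vD vc.
suff /kmin : Q k by rewrite ltnn.
by apply/asboolP; exists (a' \o lift c), (row' c D).
Qed.

(** If the generator of index [c] had a degree where [H_0] vanishes, it would be
    a combination of variables times elements of [M], and this relation would
    not be minimal. *)
Lemma generator_degree r' (a' : 'I_r' -> nat) (D : 'M[S]_(r', r)) j c :
  M 0 -> graded_mx a' a D -> generated_by D -> minimal_relations D ->
  koszul_exact a M 0 j -> a' c != j.
Proof.
move=> M0 gD MD minD ex; apply/eqP => cj.
have [|i m|y [yE yM]] := koszul_exact0 M0 ex (v := row c D).
- by apply/MD; exists (delta_mx 0 c); rewrite rowE.
- by rewrite mxE => /gD; rewrite cj.
have /choice[w wE] l : exists w, y l = w *m D by apply/MD; case: (yM l).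
have := minD (delta_mx 0 c - \sum_l 'X_l *: w l) _ c.
rewrite mulmxBl -rowE yE mulmx_suml.
under [X in _ - X]eq_bigr do rewrite -scalemxAl -wE.
move=> /(_ (subrr _)) /eqP; rewrite !mxE !eqxx /= mcoeffB mcoeff1 eqxx.
rewrite summxE raddf_sum big1 ?subr0 ?oner_eq0 // => l _.
by rewrite mxE /= mcoeffXM; case: ifP => // /mnm_lepP/(_ l); rewrite mnm1E mnm0E eqxx.
Qed.

End GradedSubmodule.
End Generators.

(** * Minimal resolutions and regularity *)

Section Resolutions.
Variables (K : fieldType) (n : nat).
Local Notation S := {mpoly K[n]}.

(** A submodule of a graded free module, bundled with the latter so that the
    iterated syzygies of an ideal form a sequence. *)
Record embedded_module := EmbeddedModule {
  ambient_rank : nat;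
  ambient_shift : 'I_ambient_rank -> nat;
  carrier : 'rV[S]_ambient_rank -> Prop
}.

Record cover (N : embedded_module) := Cover {
  cover_rank : nat;
  cover_shift : 'I_cover_rank -> nat;
  cover_map : 'M[S]_(cover_rank, ambient_rank N)
}.

Definition minimal_cover N (C : cover N) : Prop :=
  [/\ graded_mx (@cover_shift N C) (@ambient_shift N) (cover_map C),
      generated_by (@carrier N) (cover_map C) & minimal_relations (cover_map C)].

Definition syzygies N (C : cover N) : embedded_module :=
  EmbeddedModule (@cover_shift N C) (fun v => v *m cover_map C = 0).

(** For a nonzero graded module the second clause says that the regularity is
    less than [b]. *)
Definition koszul_bounded b N : Prop :=
  graded_submodule (@ambient_shift N) (@carrier N) /\
  forall i j, (i + b <= j)%N -> koszul_exact (@ambient_shift N) (@carrier N) i j.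

Lemma syzygies_bounded b N (C : cover N) :
  minimal_cover C -> koszul_bounded b N -> koszul_bounded b.+1 (syzygies C).
Proof.
move=> [gC MC minC] [_ ex]; split.
  split=> /= [|v x vC xC|p v vC|e v vC].
  - by rewrite mul0mx.
  - by rewrite mulmxDl vC xC addr0.
  - by rewrite -scalemxAl vC scaler0.
  rewrite (homog_part_mul _ _ _ gC) vC; apply/rowP => c; apply/mpolyP => m.
  by rewrite homog_partE !mxE mcoeff0 if_same.
move=> i j ij; apply: koszul_exact_syzygy gC MC minC _.
by apply: ex; rewrite addSnnS.
Qed.

Lemma exists_minimal_cover b N :
  koszul_bounded b N -> exists C : cover N, minimal_cover C.
Proof.
move=> [gN ex]; have [|r [a [D [gD MD minD]]]] := minimal_generation gN (B := b).
  by move=> j bj; apply: ex.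
by exists (Cover a D).
Qed.

Lemma cover_shift_bound b N (C : cover N) c :
  minimal_cover C -> koszul_bounded b N -> (@cover_shift N C c < b)%N.
Proof.
move=> [gC MC minC] [gN ex]; rewrite ltnNge; apply/negP => bc.
have := @generator_degree _ _ _ _ _ _ _ _ _ c (submod0 gN) gC MC minC (ex 0%N _ bc).
by rewrite eqxx.
Qed.

Definition module_of_ideal (I : S -> Prop) : embedded_module :=
  EmbeddedModule (fun _ : 'I_1 => 0%N) (fun v => I (v 0 0)).

Section BoundForAnyResolution.
Variables (I : S -> Prop) (F : free_complex K n).
Hypothesis minF : minimal_graded_free_resolution F I.

Definition syzygy_module i : embedded_module :=
  match i with
  | 0 => module_of_ideal I
  | j.+1 => EmbeddedModule (@shift _ _ F j)
      (match j return 'rV[S]_(rank F j) -> Prop with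
       | 0 => fun v => v *m aug F = 0
       | l.+1 => fun v => v *m diff F l = 0
       end)
  end.

Definition resolution_cover i : cover (syzygy_module i) :=
  match i with
  | 0 => @Cover (syzygy_module 0) _ (@shift _ _ F 0) (aug F)
  | j.+1 => @Cover (syzygy_module j.+1) _ (@shift _ _ F j.+1) (diff F j)
  end.

Lemma syzygy_moduleS i : syzygy_module i.+1 = syzygies (resolution_cover i).
Proof. by case: i. Qed.

Lemma minimal_resolution_cover i : minimal_cover (resolution_cover i).
Proof.
have [[gaug gdiff] [genI exact0 exactS] minc] := minF.
have const0 j (v : 'rV_(rank F j)) :
    (exists u, v = u *m diff F j) -> forall c, (v 0 c)@_0%MM = 0.
  move=> [u ->] c; rewrite mxE raddf_sum big1 // => k _ /=.
  by rewrite rmorphM /= minc mulr0.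
case: i => [|j]; split=> /=.
- move=> c c0 m nz; rewrite [c0]ord1 in nz *; rewrite addn0.
  by have /dhomogP := gaug c; apply; rewrite mcoeff_msupp.
- move=> x; split=> [/genI[v E]|[v ->]]; last by apply/genI; exists v.
  by exists v; apply/rowP => c; rewrite !ord1.
- by move=> v /exact0/const0.
- move=> r c m nz; have Dn0 : diff F j r c != 0.
    by apply: contraNneq nz => ->; rewrite mcoeff0.
  have [le_s /dhomogP h] := gdiff _ _ _ Dn0.
  by rewrite h ?mcoeff_msupp // subnK.
- case: j => [|j] x /=; [exact: exact0 | exact: exactS].
- by move=> v /exactS/const0.
Qed.

(** A resolution is an iteration of minimal covers starting from the ideal, and
    the bound goes up by one at each step. *)
Lemma shift_bound b i (c : 'I_(rank F i)) :
  koszul_bounded b (module_of_ideal I) -> (shift c < i + b)%N.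
Proof.
move=> b0; have bi j : koszul_bounded (j + b) (syzygy_module j).
  elim: j => // j IH; rewrite syzygy_moduleS.
  exact: syzygies_bounded (minimal_resolution_cover j) IH.
have := cover_shift_bound _ (minimal_resolution_cover i) (bi i).
by case: i c => [|i] c; apply.
Qed.

End BoundForAnyResolution.

Section Existence.
Variables (I : S -> Prop) (b : nat).
Hypothesis bI : koszul_bounded b (module_of_ideal I).

Definition some_cover N : cover N :=
  epsilon (inhabits (Cover (@ambient_shift N) 0)) (@minimal_cover N).

(** Unfolding one more iteration is a conversion, so the cover maps of two
    consecutive terms have the types required of the differentials. *)
Definition syzygy_chain i : embedded_module :=
  iter i (fun N => syzygies (some_cover N)) (module_of_ideal I).

Lemma syzygy_chain_bounded i : koszul_bounded (i + b) (syzygy_chain i).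
Proof.
elim: i => // i IH; apply: (syzygies_bounded _ (IH)).
by apply: epsilon_spec; apply: exists_minimal_cover IH.
Qed.

Lemma minimal_some_cover i : minimal_cover (some_cover (syzygy_chain i)).
Proof.
by apply: epsilon_spec; apply: exists_minimal_cover (syzygy_chain_bounded i).
Qed.

Definition minimal_resolution : free_complex K n :=
  @FreeComplex K n (fun i => ambient_rank (syzygy_chain i.+1))
    (fun i => @ambient_shift (syzygy_chain i.+1))
    (fun i => cover_map (some_cover (syzygy_chain i.+1)))
    (cover_map (some_cover (syzygy_chain 0))).

Lemma minimal_resolutionP : minimal_graded_free_resolution minimal_resolution I.
Proof.
have graded i := let: And3 h _ _ := minimal_some_cover i in h.
have gens i := let: And3 _ h _ := minimal_some_cover i in h.
have mins i := let: And3 _ _ h := minimal_some_cover i in h.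
split.
- split=> [c|i r c nz].
    apply/dhomogP => m; rewrite mcoeff_msupp => /(graded 0%N c 0 m) /=.
    by rewrite addn0.
  have [m nzm] : exists m, (diff minimal_resolution i r c)@_m != 0.
    by exists (mlead (diff minimal_resolution i r c)); rewrite -mcoeff_msupp mlead_supp.
  have degE m' : (diff minimal_resolution i r c)@_m' != 0 ->
      (mdeg m' + shift c = shift r)%N by apply: (graded i.+1 r c m').
  split; first by rewrite -(degE m nzm) leq_addl.
  by apply/dhomogP => m'; rewrite mcoeff_msupp => /degE <-; rewrite addnK.
- split=> [x|v|i v]; last 2 first.
  + exact: (gens 1%N v).
  + exact: (gens i.+2 v).
  have := gens 0%N (const_mx x); rewrite /= mxE => ->.
  split=> -[v E]; exists v; first by rewrite -[RHS]/((v *m _) 0 0) -E mxE.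
  by apply/rowP => c; rewrite !ord1 mxE E.
move=> i r c.
pose v : 'rV_(rank minimal_resolution i) := row r (diff minimal_resolution i).
have -> : diff minimal_resolution i r c = v 0 c by rewrite mxE.
apply: (mins i); have /= -> := gens i.+1 v.
by exists (delta_mx 0 r); rewrite /v rowE.
Qed.

(** The nonzero element [x] makes the first free module nonzero. The shifts
    being bounded, the largest difference is attained, so [is_regularity] has
    a solution and [reg] is one. *)
Lemma reg_bound (x : S) : I x -> x != 0 -> reg I <= b%:Z - 1.
Proof.
move=> Ix x0; have F := minimal_resolutionP.
have [r rP] : exists r, is_regularity I r.
  (* The least gap d gives the largest value of the shift minus the index. *)
  pose P d := `[< exists i (c : 'I_(rank minimal_resolution i)),
    (shift c + d.+1 = i + b)%N >].
  have exP : exists d, P d.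
    have [v xv] : exists v : 'rV_(rank minimal_resolution 0),
        x = (v *m aug minimal_resolution) 0 0.
      by have [_ [genI _ _] _] := F; exact: (proj1 (genI x) Ix).
    have [c] : exists c : 'I_(rank minimal_resolution 0), True.
      apply: contraNP x0 => no; rewrite xv mxE big1 // => c _.
      by case: no; exists c.
    move=> _; have lt := shift_bound F c bI.
    exists (b - (shift c).+1)%N; apply/asboolP; exists 0%N, c.
    by rewrite addnS -addSn subnKC.
  case: (ex_minnP exP) => d /asboolP[i [c cd]] dmin.
  exists ((i + b)%N%:Z - d.+1%:Z - i%:Z), minimal_resolution; split=> //.
    move=> i' c'; have lt := shift_bound F c' bI.
    have : (d <= i' + b - (shift c').+1)%N.
      by apply: dmin; apply/asboolP; exists i', c'; rewrite addnS -addSn subnKC.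
    move: cd lt; lia.
  by exists i, c; move: cd; lia.
have [G [minG _ [i [c <-]]]] : is_regularity I (reg I).
  by apply: epsilon_spec; exists r.
by have := shift_bound minG c bI; lia.
Qed.

End Existence.
End Resolutions.

(** * Regularity of powers of bipartite edge ideals *)

Section BipartiteEdgePowers.
Variables (K : fieldType) (n : nat) (W : {set 'I_n}) (e : rel 'I_n).
Hypothesis e_sym : forall u v, e u v -> e v u.
Hypothesis e_bip : forall u v, e u v -> (u \in W) = (v \notin W).
Variable q : nat.
Local Notation Iq := (ideal_pow (edge_ideal K e) q).

Lemma edge_power_graded :
  graded_submodule (fun _ : 'I_1 => 0%N) (fun v : 'rV_1 => Iq (v 0 0)).
Proof.
have IqE (x : {mpoly K[n]}) := ideal_powE e_sym e_bip q x.
split=> [|v x /IqE vq /IqE xq|p v /IqE vq|d v /IqE vq]; apply/IqE => m.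
- by rewrite mxE mcoeff0 eqxx.
- rewrite mxE mcoeffD; case: (eqVneq (v 0 0)@_m 0) => [->|/vq //].
  by rewrite add0r => /xq.
- rewrite mxE => /mcoeffM_neq0[m1 [m2 [-> _ /vq m2q]]].
  by rewrite addmC; apply: mono_powDr.
- by rewrite homog_partE; case: (_ == d); rewrite ?eqxx // => /vq.
Qed.

(** Strand by strand, this is [exact_at_flow]. *)
Lemma edge_power_bounded : (0 < #|~: W|)%N ->
  koszul_bounded (2 * q + #|~: W|) (module_of_ideal Iq).
Proof.
have IqE (x : {mpoly K[n]}) := ideal_powE e_sym e_bip q x.
move=> W0; split=> [|i j ij]; first exact: edge_power_graded.
move=> w [wI wh] dw.
have [||x [xI xh] wx] :=
    @koszul_lift _ _ _ (fun _ : 'I_1 => 0%N) (fun _ => mono_pow W e q) i j w.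
- by split.
- move=> c u; rewrite [c]ord1 addn0 => uj.
  apply: (eq_exact_at (flow_complex_shift W e q u)).
  + apply: (exact_at_flow (@oriented_bip n W e e_bip)) => //.
    by rewrite uj addnAC -addnA addnC -addnA; move: ij; lia.
  + move=> A; rewrite /strand; case: ifP => // Au; rewrite ?eqxx // => nz.
    split; last by have [] := wh _ _ _ nz.
    by split=> //; apply: (iffLR (IqE _) (wI A)).
  + by move=> A; rewrite -strand_koszul_d /strand dw mxE mcoeff0 if_same.
exists x => //; split=> // A; apply/IqE => m; exact: xI.
Qed.

Theorem reg_bipartite_edge_power u v : e u v ->
  reg Iq <= (2 * q + #|~: W|)%N%:Z - 1.
Proof.
move=> uv; have W0 : (0 < #|~: W|)%N.
  apply/card_gt0P; case: (boolP (u \in W)) => uW; last by exists u; rewrite inE.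
  by exists v; rewrite inE -(e_bip uv).
apply: (reg_bound (edge_power_bounded W0) (x := ('X_u * 'X_v) ^+ q)).
  exists 1%N, (fun=> 1), (fun=> ('X_u * 'X_v) ^+ q); split; last first.
    by rewrite big_ord1 mul1r.
  move=> _; exists (fun=> 'X_u * 'X_v); split; last by rewrite prodr_const card_ord.
  move=> _; exists 1%N, (fun=> 1), (fun=> 'X_u * 'X_v).
  by split; [move=> _; exists u, v | rewrite big_ord1 mul1r].
by rewrite expf_neq0 // mulf_neq0 // -msupp_eq0 msuppX.
Qed.

End BipartiteEdgePowers.

Theorem corollary8p7 (R : realType) (K : fieldType) (d k s : nat)
    (F : 'I_k -> {mpoly R[i][3]}) (p : 'I_s -> P2 R)
    (harr : d_arrangement d F)
    (p_inj : injective p)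
    (p_Sing : forall P : P2 R, in_Sing F P <-> exists j : 'I_s, p j = P)
    (hks : (k <= s)%N) (q : nat) (hq : (1 <= q)%N) :
  reg (ideal_pow (edge_ideal K (levi_graph F p)) q) <= (2 * q + k)%N%:Z - 1.
Proof.
pose W : {set 'I_(s + k)} := [set lshift k j | j : 'I_s].
have lW j : lshift k j \in W by apply: imset_f.
have rW i : rshift s i \notin W.
  by apply/imsetP => -[j _ /eqP]; rewrite eq_sym eq_lrshift.
have cardW : #|~: W| = k.
  by rewrite cardsCs setCK card_ord card_imset ?card_ord ?addKn //; apply: lshift_inj.
have k3 := arr_size harr; have j0 : 'I_s := Ordinal (leq_trans (ltnW (ltnW k3)) hks).
have [i [_ [_ on_i _]]] : in_Sing F (p j0) by apply/p_Sing; exists j0.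
rewrite -[X in (2 * q + X)%N]cardW.
apply: (@reg_bipartite_edge_power _ _ W (levi_graph F p) _ _ q
  (lshift k j0) (rshift s i)).
- move=> u v; rewrite /levi_graph.
  by case: (split u) => a; case: (split v) => b.
- move=> u v; rewrite /levi_graph.
  case: (split_ordP u) => [a|a] ->; case: (split_ordP v) => [b|b] -> //= _.
    by rewrite lW rW.
  by rewrite lW (negbTE (rW a)).
by rewrite /levi_graph !(unsplitK (inl _)) !(unsplitK (inr _)).
Qed.
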